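(* Let $\nu\in\nu_0+\mathbb{N}$. The coefficients of the three-term recurrence relation $$xP_n^{(\alpha,\nu)}(x)=P_{n+1}^{(\alpha,\nu)}(x)+B_n^{(\alpha,\nu)}P_n^{(\alpha,\nu)}(x)+C_n^{(\alpha,\nu)}P_{n-1}^{(\alpha,\nu)}(x)$$ for the monic Hermite-type polynomials are given by $$B_n^{(\alpha,\nu)}=\tfrac12A^\alpha+\tfrac14\Bigl(N+1-J+\tfrac{c^{(\nu+n-1)}}{d^{(\nu+n-1)}}\Bigr)^{-1}\Bigl(N+1-J+\tfrac{c^{(\nu+n)}}{d^{(\nu+n)}}\Bigr)^{-1}$$ $$\times\Bigl(N+1-J+\Bigl((n+1)\tfrac{c^{(\nu+n-1)}}{d^{(\nu+n-1)}}-n\tfrac{c^{(\nu+n)}}{d^{(\nu+n)}}\Bigr)\Bigr)\,J(N-J)\,S^\alpha A^\ast(S^\alpha)^{-1},\qquad n\ge0,$$ $$\bigl(C_n^{(\alpha,\nu)}\bigr)_{p,q}=\delta_{p,q}\,\frac{-n}{2\,d^{(\nu+n-1)}}\,\frac{\delta_1^{(\nu+n)}}{\delta_1^{(\nu+n-1)}}\,\frac{\bigl(-N-\frac{c^{(\nu+n)}}{d^{(\nu+n)}}\bigr)_{p-1}}{\bigl(-N-\frac{c^{(\nu+n-1)}}{d^{(\nu+n-1)}}\bigr)_{p}},\qquad n\ge1,\ p,q\in\{1,\dots,N\},$$ where for $n=0$ the expression for $B_0^{(\alpha,\nu)}$ is understood after cancelling the first inverse against the third factor, i.e. $B_0^{(\alpha,\nu)}=\frac12A^\alpha+\frac14\bigl(N+1-J+\frac{c^{(\nu)}}{d^{(\nu)}}\bigr)^{-1}J(N-J)S^\alpha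 A^\ast(S^\alpha)^{-1}$.
   Context: $N\ge1$ is an integer, $\mathbb{N}=\{0,1,2,\dots\}$, $(a)_k=a(a+1)\cdots(a+k-1)$ is the Pochhammer symbol. Scalars in matrix expressions denote multiples of the identity, and $^\ast$ is the conjugate transpose. $H_n$ are the Hermite polynomials defined by $\sum_{n\ge0}\frac{t^n}{n!}H_n(x)=e^{2xt-t^2}$. $L(x)$ is the lower triangular $N\times N$ matrix with $L(x)_{m,n}=\frac{H_{m-n}(x)}{(m-n)!}$ for $m\ge n$ and $0$ for $m<n$, $m,n\in\{1,\dots,N\}$. $A=2\sum_{j=2}^NE_{j,j-1}$ with $E_{j,k}$ the matrix units. $\alpha_1,\dots,\alpha_N$ are non-zero real numbers with $\alpha_1=1$, $S^\alpha=\mathrm{diag}(\alpha_1,\dots,\alpha_N)$, $L^\alpha(x)=S^\alpha L(x)(S^\alpha)^{-1}$, $A^\alpha=S^\alpha A(S^\alpha)^{-1}$, $J=\mathrm{diag}(1,2,\dots,N)$. Fix $\nu_0$. For each $\nu\in\nu_0+\mathbb{N}$ let $\Delta^{(\nu)}=\mathrm{diag}(\delta_1^{(\nu)},\dots,\delta_N^{(\nu)})$ have positive diagonal entries and let $c^{(\nu)},d^{(\nu)}$ be positive reals. Assumptions: for all $\nu\in\nu_0+\mathbb{N}$, $$\Delta^{(\nu+1)}=(d^{(\nu)}J+c^{(\nu)})\Delta^{(\nu)},\qquad \frac{\alpha_{k+1}^2}{\alpha_k^2}=\frac{d^{(\nu)}k(N-k)}{2(d^{(\nu)}k+c^{(\nu)})}\frac{\delta_{k+1}^{(\nu)}}{\delta_k^{(\nu)}},\quad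 k=1,\dots,N-1.$$ The weight on $\mathbb{R}$ is $W^{(\alpha,\nu)}(x)=e^{-x^2}L^\alpha(x)\Delta^{(\nu)}L^\alpha(x)^\ast$, and $P_n^{(\alpha,\nu)}$ is the unique matrix polynomial of degree $n$ with leading coefficient the identity such that $\int_{\mathbb{R}}P_n^{(\alpha,\nu)}(x)W^{(\alpha,\nu)}(x)P_m^{(\alpha,\nu)}(x)^\ast dx=0$ for $n\neq m$; $P_{-1}^{(\alpha,\nu)}=0$. *)

(* Defs.v *)
From HB Require Import structures.
From mathcomp Require Import all_boot all_order all_algebra.
From mathcomp Require Import complex.
From mathcomp Require Import all_classical all_reals all_analysis.
Import numFieldNormedType.Exports.
Import Order.TTheory GRing.Theory Num.Theory.

Set Implicit Arguments.
Unset Strict Implicit.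
Unset Printing Implicit Defensive.

Local Open Scope classical_set_scope.
Local Open Scope ring_scope.
Local Open Scope complex_scope.
Local Open Scope sesquilinear_scope.

(* Row and column indices run over 'I_N, so the index written i below stands
   for the index i.+1 in {1, ..., N}.  All matrices are complex, and ^t* is
   the conjugate transpose. *)

Section HermiteType.
Context {R : realType}.
Local Notation C := R[i].

(* The exponential generating function of the Hermite polynomials. *)
Definition hermite_polys (H : nat -> {poly R}) : Prop :=
  forall x t : R,
    series (fun n => t ^+ n / n`!%:R * (H n).[x]) @ \oo
      --> expR (2 * x * t - t ^+ 2).

Definition pochhammer (a : R) (k : nat) : R := \prod_(i < k) (a + i%:R).

Definition nat_shift (nu0 : R) : set R :=
  [set nu | exists k : nat, nu = nu0 + k%:R].

Section Matrices.
Variable N : nat.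

Definition diagC (v : 'I_N -> R) : 'M[C]_N := diag_mx (\row_i (v i)%:C).

Definition Jmx : 'M[C]_N := diagC (fun i => i.+1%:R).

Definition Amx : 'M[C]_N :=
  2 *: \sum_(i < N) \sum_(j < N | i == j.+1 :> nat) delta_mx i j.

Definition Lmx (H : nat -> {poly R}) (x : R) : 'M[C]_N :=
  \matrix_(m, n)
    if (n <= m)%N then ((H (m - n)%N).[x] / ((m - n)%N)`!%:R)%:C else 0.

Definition conjS (alpha : 'I_N -> R) (M : 'M[C]_N) : 'M[C]_N :=
  diagC alpha *m M *m invmx (diagC alpha).

Definition weight (H : nat -> {poly R}) (alpha : 'I_N -> R)
    (delta : R -> 'I_N -> R) (nu x : R) : 'M[C]_N :=
  (expR (- x ^+ 2))%:C *:
    (conjS alpha (Lmx H x) *m diagC (delta nu)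
       *m (conjS alpha (Lmx H x))^t*).

Definition mx_integral (F : R -> 'M[C]_N) : 'M[C]_N :=
  \matrix_(i, j)
    ((\int[@lebesgue_measure R]_x complex.Re (F x i j))
       +i* (\int[@lebesgue_measure R]_x complex.Im (F x i j))).

(* For n = 0 the values at nu - 1, which are not constrained when nu = nu0,
   do not appear. *)
Definition Bcoef (alpha : 'I_N -> R) (c d : R -> R) (nu : R) (n : nat) :
    'M[C]_N :=
  let K (r : R) : 'M[C]_N := N%:R%:M + 1%:M - Jmx + r%:C%:M in
  let r0 := c (nu + n%:R - 1) / d (nu + n%:R - 1) in
  let r1 := c (nu + n%:R) / d (nu + n%:R) in
  let F := if n == 0%N then invmx (K r1)
           else invmx (K r0) *m invmx (K r1)
                  *m K ((n.+1)%:R * r0 - n%:R * r1) in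
  2^-1 *: conjS alpha Amx
  + 4^-1 *: (F *m (Jmx *m (N%:R%:M - Jmx)) *m conjS alpha (Amx^t*)).

End Matrices.

(* p is 0-based: the exponent written p - 1 with p in {1, ..., N} is p here. *)
Definition Ccoef (N' : nat) (delta : R -> 'I_N'.+1 -> R) (c d : R -> R)
    (nu : R) (n : nat) : 'M[C]_N'.+1 :=
  let nu_p := nu + n%:R - 1 in
  let nu_n := nu + n%:R in
  diagC (fun p : 'I_N'.+1 =>
    (- n%:R / (2 * d nu_p)) * (delta nu_n ord0 / delta nu_p ord0)
    * (pochhammer (- N'.+1%:R - c nu_n / d nu_n) p
       / pochhammer (- N'.+1%:R - c nu_p / d nu_p) p.+1)).

(* R[i]-matrix coefficients stand on the left of the powers of x. *)
Definition eval_mx (N' : nat) (P : {poly 'M[C]_N'.+1}) (x : R) :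
    'M[C]_N'.+1 := P.[x%:C%:M].

Definition monic_orthogonal (N' : nat) (W : R -> 'M[C]_N'.+1)
    (P : nat -> {poly 'M[C]_N'.+1}) : Prop :=
  [/\ forall n, size (P n) = n.+1,
      forall n, P n \is monic
    & forall n m, n <> m ->
        mx_integral (fun x => eval_mx (P n) x *m W x *m (eval_mx (P m) x)^t*)
          = 0].

End HermiteType.

(* Main.v *)
From HB Require Import structures.
From mathcomp Require Import all_boot all_order all_algebra.
From mathcomp Require Import complex.
From mathcomp Require Import all_classical all_reals all_analysis.
Require Import Defs.
Import numFieldNormedType.Exports.
Import Order.TTheory GRing.Theory Num.Theory.
From mathcomp Require Import measurable_realfun.
From mathcomp Require Import ring lra.

Set Implicit Arguments.
Unset Strict Implicit.
Unset Printing Implicit Defensive.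

Local Open Scope ring_scope.

(** Write w_nu = L Delta_nu L^H for the polynomial part of the weight, s for
    half of A^alpha, f for J (N - J) S A^H S^-1 / 2, r = c / d and
    K = N + 1 - J + r, where ^H is the conjugate transpose.  Consecutive weights
    are linked by two Pearson equations
      w_(nu+1) = Phi w_nu   and   w_(nu+1)' - 2 x w_(nu+1) = Psi w_nu,
    where Phi has degree at most one in x, Psi = - 2 d K (x - b) and
    b = s + K^-1 f / 2.  They come from the commutation rules J s - s J = s
    and s f - f s = 2 J - N - 1, and from the expansion
    L = sum_j (H_j / j!) s^j: the recurrence of the Hermite polynomials makes
    the commutators of L with J and f explicit (nilp_sum_J, nilp_sum_f), and
    the hypothesis on alpha says exactly that Delta_(nu+1) (2 s)^H = d f Delta_nu
    (wpoly_step, wpoly_deriv).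

    Integration by parts against exp(- x^2) turns the Pearson equations into
      <P', Q>_(nu+1) = - <P, Q' Phi + Q Psi>_nu                    (ip_deriv).
    Since Q' Phi + Q Psi has degree at most one more than Q, the polynomials
    P_(n+1)' / (n+1) are monic orthogonal for nu + 1 as soon as the P_n are so
    for nu.  Orthogonal polynomials for all nu + k are thus obtained by
    differentiating the given ones k times, and everything reduces to degree
    at most one.
    - The degree-one polynomial for nu + n is x - b_(nu+n), because integrating
      the second Pearson equation gives <Psi, 1> = 0.  It is also a multiple of
      the n-th derivative of P_(n+1), so the coefficient of x^n in P_(n+1) is
      - (n+1) b_(nu+n) (coef_sublead), and comparing subleading coefficients
      gives B_n = (n+1) b_(nu+n) - n b_(nu+n-1).
    - The same identity with Q = x^n relates <P_(n+1), x^(n+1)>_nu 2 d K to the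
      norm of degree n for nu + 1 (ip_deriv_ops).  Iterating, C_n = n e_(nu+n-1),
      where e is the solution of e M_nu 2 d K = M_(nu+1) and M_nu is the
      integral of the weight (ip_lead_rec).
    With these B_n and C_n the polynomial x P_n - P_(n+1) - B_n P_n - C_n P_(n-1)
    has degree less than n and is orthogonal to all polynomials of degree less
    than n, hence to itself; the form is definite, so it vanishes
    (three_term_recurrence).

    To find e, integrate the first Pearson equation: M_(nu+1) = D M_nu with D an
    explicit diagonal matrix with distinct entries.  Both integrals are
    Hermitian, so D and then K commute with M_nu, and e = D (2 d K)^-1
    (moment_wH_step, eHE).  For N > 1 the hypotheses force c / d to grow by one
    when nu does (rHS); this makes the quotient of Pochhammer symbols in C_n
    telescope to e. *)


(** * Integrals of polynomials against the Gaussian *)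

Section GaussianIntegral.
Context {R : realType}.
Local Open Scope classical_set_scope.
Implicit Types p q : {poly R}.
Local Notation mu := (@lebesgue_measure R).

Definition gauss_poly p (x : R) : R := p.[x] * gauss_fun x.

Lemma exprn_le_expR (x : R) n : `|x| ^+ n <= n`!%:R * expR `|x|.
Proof.
case: n => [|n].
  by rewrite expr0 fact0 mul1r (le_trans _ (expR_ge1Dx _))// lerDl.
rewrite mulrC -ler_pdivrMr ?ltr0n ?fact_gt0//.
by rewrite (le_trans _ (expR_ge1Dxn n (normr_ge0 x)))// lerDr.
Qed.

(** As |x|^i <= i! exp(|x|) and |x| <= (1 + x^2) / 2, every polynomial is at most
    a multiple of exp(x^2 / 2), and half of the Gaussian decay is left over. *)
Lemma gauss_poly_bound p : exists2 C : R, 0 <= C &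
  forall x, `|gauss_poly p x| <= C * expR (- x ^+ 2 / 2).
Proof.
exists (\sum_(i < size p) `|p`_i| * (i`!%:R * expR (1 / 2))).
  by apply: sumr_ge0 => i _; rewrite !mulr_ge0 ?expR_ge0.
move=> x; rewrite /gauss_poly normrM (ger0_norm (gauss_fun_ge0 x)) /gauss_fun.
have -> : expR (- x ^+ 2) = (expR (x ^+ 2 / 2))^-1 * expR (- x ^+ 2 / 2).
  by rewrite -expRN -expRD; congr expR; field.
rewrite mulrA ler_pM2r ?expR_gt0// ler_pdivrMr ?expR_gt0// horner_coef.
rewrite (le_trans (ler_norm_sum _ _ _))// mulr_suml ler_sum// => i _.
rewrite normrM -!mulrA ler_wpM2l// normrX (le_trans (exprn_le_expR _ _))//.
rewrite ler_wpM2l// -expRD ler_expR.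
have := real_normK (num_real x); have := sqr_ge0 (`|x| - 1).
rewrite sqrrB1 !expr2; lra.
Qed.

Lemma integrable_half_gauss :
  mu.-integrable setT (EFin \o (fun x => expR (- x ^+ 2 / 2))).
Proof.
have /(integrableZl measurableT (normal_peak (1 : R))^-1) :=
  integrable_normal_pdf (0 : R) (1 : R).
apply: eq_integrable => // x _ /=.
rewrite normal_pdfE ?oner_eq0//= -EFinM mulKf ?gt_eqF ?normal_peak_gt0 ?oner_eq0//.
by rewrite /normal_fun subr0 expr1n.
Qed.

Lemma continuous_gauss_poly p : continuous (gauss_poly p).
Proof.
by move=> x; apply: cvgM; [exact: continuous_horner|exact: continuous_gauss_fun].
Qed.

Lemma integrable_gauss_poly p : mu.-integrable setT (EFin \o gauss_poly p).
Proof.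
have [C C0 CP] := gauss_poly_bound p.
apply: (le_integrable measurableT _ _
  (integrableZl measurableT C integrable_half_gauss)).
  apply/measurable_EFinP; apply: continuous_measurable_fun.
  exact: continuous_gauss_poly.
move=> x _ /=; rewrite lee_fin.
by rewrite (le_trans (CP x))// ler_norm.
Qed.

Lemma is_derive_gauss_poly p (x : R) :
  is_derive x (1 : R) (gauss_poly p) (gauss_poly (p^`() - 2 *: ('X * p)) x).
Proof.
have -> : gauss_poly p = (horner p * (expR \o (fun y => - y ^+ 2)))%R by [].
apply: is_derive_eq.
rewrite /gauss_poly !hornerE /gauss_fun /= /GRing.scale/= !mulr1 !mulr_natl; ring.
Qed.

Lemma gauss_poly_cvg0 p (s : R) : `|s| = 1 ->
  gauss_poly p (s * k%:R) @[k --> \oo] --> 0.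
Proof.
move=> s1; have [C C0 CP] := gauss_poly_bound p.
apply/cvgrPdist_le => e e0; near=> k.
rewrite sub0r normrN (le_trans (CP _))//.
have k0 : 0 < (k%:R : R) by rewrite ltr0n; near: k; exact: nbhs_infty_gt.
have -> : - (s * k%:R) ^+ 2 / 2 = - (k%:R ^+ 2 / 2) :> R.
  by rewrite exprMn -(real_normK (num_real s)) s1 expr1n mul1r mulNr.
rewrite expRN ler_pdivrMr ?expR_gt0//.
have h : k%:R <= expR (k%:R ^+ 2 / 2) :> R.
  apply: le_trans (expR_ge1Dx _).
  have := sqr_ge0 (k%:R - 1 : R); rewrite sqrrB1 !expr2; lra.
rewrite (@le_trans _ _ (e * k%:R))// ?ler_pM2l//.
rewrite mulrC -ler_pdivrMr//; near: k; exact: nbhs_infty_ger.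
Unshelve. all: by end_near. Qed.

(** The integrand is the derivative of p exp(- x^2), which vanishes at both
    infinities; dominated convergence passes from [-k, k] to the real line. *)
Lemma integral_gauss_poly_deriv p :
  \int[mu]_x gauss_poly (p^`() - 2 *: ('X * p)) x = 0.
Proof.
set q := _ - _.
pose D (k : nat) := `[- 1 * k%:R, 1 * k%:R]%classic : set R.
have FTC k : (\int[mu]_x (((EFin \o gauss_poly q) \_ (D k)) x) =
    (gauss_poly p (1 * k%:R))%:E - (gauss_poly p (- 1 * k%:R))%:E)%E.
  rewrite -integral_mkcond.
  have [->|k0] := posnP k.
    by rewrite /D !mulr0 set_itv1 integral_set1 subee.
  apply: continuous_FTC2.
  - by rewrite mulN1r mul1r gtrN ?ltr0n.
  - by apply: continuous_subspaceT; exact: continuous_gauss_poly.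
  - split; first by move=> x _; have [] := is_derive_gauss_poly p x.
      by apply: cvg_at_right_filter; exact: continuous_gauss_poly.
    by apply: cvg_at_left_filter; exact: continuous_gauss_poly.
  - by move=> x _; rewrite derive1E; have [_ ->] := is_derive_gauss_poly p x.
have h1 : (\int[mu]_x (((EFin \o gauss_poly q) \_ (D k)) x) @[k --> \oo]
    --> \int[mu]_x (gauss_poly q x)%:E)%E.
  apply: (@dominated_cvg _ _ _ mu setT measurableT
     (fun k => (EFin \o gauss_poly q) \_ (D k)) (EFin \o gauss_poly q)
     (abse \o (EFin \o gauss_poly q))) => //.
  - move=> k; apply/(measurable_restrictT _ _).1 => //; first exact: measurable_itv.
    by apply: measurable_funTS; apply: measurable_int (integrable_gauss_poly q).
  - move=> x _; apply: cvg_near_cst; near=> k.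
    rewrite patchE mem_set// /D /= in_itv/= mulN1r mul1r -ler_norml.
    near: k; exact: nbhs_infty_ger.
  - exact/integrable_abse/integrable_gauss_poly.
  - move=> k x _; rewrite patchE; case: ifP => // _.
    by rewrite abse0 abse_ge0.
have h2 : (\int[mu]_x (((EFin \o gauss_poly q) \_ (D k)) x) @[k --> \oo]
    --> 0%:E)%E.
  under eq_fun do rewrite FTC -EFinB.
  apply: cvg_EFin; first by near=> k.
  rewrite -[0]subr0; apply: cvgB; apply: gauss_poly_cvg0.
    by rewrite normr1.
  by rewrite normrN1.
by rewrite /Rintegral (cvg_unique _ h1 h2).
Unshelve. all: by end_near. Qed.

(** A polynomial vanishing almost everywhere has uncountably many roots. *)
Lemma integral_gauss_poly_eq0 p : (forall x, 0 <= p.[x]) ->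
  \int[mu]_x gauss_poly p x = 0 -> p = 0.
Proof.
move=> p0 ip0; apply: contrapT => /eqP pn0.
have ge0 x : 0 <= gauss_poly p x by rewrite mulr_ge0// gauss_fun_ge0.
have int0 : (\int[mu]_x `|(EFin \o gauss_poly p) x| = 0)%E.
  under eq_integral do rewrite gee0_abs ?lee_fin//.
  rewrite -[LHS]fineK; last exact: integrable_fin_num (integrable_gauss_poly p).
  congr EFin; exact: ip0.
have /(ae_eq_integral_abs _ measurableT
  (measurable_int _ (integrable_gauss_poly p))) [N [mN N0 sN]] :=
  int0.
have cZ : countable [set x | root p x].
  apply: finite_set_countable; apply: contrapT.
  move=> /(infinite_set_fset (size p))[B BZ]; apply/negP; rewrite -ltnNge.
  apply: max_poly_roots pn0 _ (finmap.fset_uniq B).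
  by apply/allP => x xB; exact: BZ.
have mZ : measurable [set x | root p x] by exact: countable_measurable.
(* The line is covered by the exceptional null set and the roots of p. *)
have : mu [set: R] = 0%E.
  apply/eqP; rewrite eq_le measure_ge0 andbT.
  have <- : mu (N `|` [set x | root p x]) = 0%E.
    by rewrite measureU0//; exact: countable_lebesgue_measure0.
  apply: le_measure; rewrite ?inE//; first exact: measurableU.
  move=> x _; have [|px] := boolP (root p x); first by right.
  left; apply: sN => /= /(_ I) [] /eqP.
  by rewrite mulf_eq0 -rootE (negPf px) /= gt_eqF// expR_gt0.
by rewrite -set_itvNyy lebesgue_measure_itv/=.
Qed.

Definition gauss_int p : R := \int[mu]_x gauss_poly p x.

Fact gauss_int_is_zmod_morphism : zmod_morphism gauss_int.
Proof.
move=> p q; rewrite /gauss_int -RintegralB//; try exact: integrable_gauss_poly.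
by apply: eq_Rintegral => x _; rewrite /gauss_poly !hornerE mulrBl.
Qed.
HB.instance Definition _ :=
  GRing.isZmodMorphism.Build {poly R} R gauss_int gauss_int_is_zmod_morphism.

Lemma gauss_intZ (a : R) p : gauss_int (a *: p) = a * gauss_int p.
Proof.
rewrite /gauss_int -RintegralZl//; last exact: integrable_gauss_poly.
by apply: eq_Rintegral => x _; rewrite /gauss_poly hornerZ mulrA.
Qed.

Definition gauss_moment k : R := gauss_int 'X^k.

Lemma gauss_intE n p : (size p <= n)%N ->
  gauss_int p = \sum_(k < n) p`_k * gauss_moment k.
Proof.
move=> pn; have {1}-> : p = \sum_(k < n) p`_k *: 'X^k.
  rewrite -poly_def; apply/polyP => i; rewrite coef_poly; case: ltnP => // ni.
  by rewrite nth_default// (leq_trans pn).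
by rewrite raddf_sum; apply: eq_bigr => k _; rewrite /= gauss_intZ.
Qed.

Lemma gauss_momentS k : gauss_moment k.+1 *+ 2 = gauss_moment k.-1 *+ k.
Proof.
have := integral_gauss_poly_deriv 'X^k; rewrite -/(gauss_int _) raddfB/= gauss_intZ.
rewrite derivXn raddfMn/= -exprS mulr_natl => /eqP.
by rewrite subr_eq0 => /eqP.
Qed.

End GaussianIntegral.

(** * Hermite polynomials from their generating function *)

Lemma poly_eq0_nat (F : numDomainType) (p : {poly F}) :
  (forall n : nat, p.[n%:R] = 0) -> p = 0.
Proof.
move=> p0; apply/eqP; apply: contraT => pn0.
have := max_poly_roots pn0 (rs := [seq i%:R | i <- iota 0 (size p)]).
rewrite size_map size_iota ltnn => -> //.
  by apply/allP => _ /mapP[i _ ->]; rewrite rootE p0.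
rewrite map_inj_uniq ?iota_uniq// => i j /eqP; rewrite eqr_nat => /eqP//.
Qed.

Section HermiteRecurrence.
Context {R : realType}.
Local Open Scope classical_set_scope.
Implicit Types (a b : nat -> R) (x t : R).

(** Comparison with the series at y = 2 (|t| + 1): the factor n + 1 is absorbed
    by 2^(n+1). *)
Lemma is_cvg_pseries_diffs a :
  (forall t, cvgn (pseries a t)) -> forall t, cvgn (pseries (pseries_diffs a) t).
Proof.
move=> ca t; pose y := 2 * (`|t| + 1).
have y0 : 0 <= y by rewrite mulr_ge0// addr_ge0.
have cy : cvgn (pseries (fun i => `|a i|) y).
  apply: (is_cvg_pseries_inside_norm (ca (y + 1))).
  by rewrite !ger0_norm ?addr_ge0// ltrDl.
apply: normed_cvg; apply: (@series_le_cvg _ _ (fun n => `|a n.+1| * y ^+ n.+1)).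
- by move=> n; exact: normr_ge0.
- by move=> n; rewrite mulr_ge0// exprn_ge0.
- move=> n; rewrite /= normrM normrX /pseries_diffs normrM normr_nat.
  rewrite mulrAC mulrC ler_wpM2l// exprMn ler_pM ?exprn_ge0//.
    by rewrite -natrX ler_nat ltnW// ltn_expl.
  rewrite (@le_trans _ _ ((`|t| + 1) ^+ n))//.
    by rewrite lerXn2r ?nnegrE ?addr_ge0// lerDl.
  by rewrite ler_weXn2l// lerDr.
- rewrite (_ : series _ = (fun n => pseries (fun i => `|a i|) y n.+1 - `|a 0%N|)).
    apply: is_cvgB; last exact: is_cvg_cst.
    by move/cvg_ex: cy => [l cl]; apply/cvg_ex; exists l; rewrite cvg_shiftS.
  apply/funext => n; rewrite /pseries /series /= big_nat_recl//.
  by rewrite expr0 mulr1 [X in X - _]addrC addrK.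
Qed.

Lemma is_derive_pseries a t : (forall t, cvgn (pseries a t)) ->
  is_derive t (1 : R) (fun t => limn (pseries a t))
    (limn (pseries (pseries_diffs a) t)).
Proof.
move=> ca; have cda := is_cvg_pseries_diffs ca.
apply: (@pseries_snd_diffs _ _ (`|t| + 1)) => //.
  exact: is_cvg_pseries_diffs.
by rewrite [ltRHS]ger0_norm ?addr_ge0// ltrDl.
Qed.

Lemma pseries_at0 a : limn (pseries a 0) = a 0%N.
Proof.
apply/lim_near_cst => //; near=> n.
have n0 : (0 < n)%N by near: n; exact: nbhs_infty_gt.
rewrite /pseries /series/= -(prednK n0) big_nat_recl// expr0 mulr1 big1 ?addr0//.
by move=> i _; rewrite expr0n mulr0.
Unshelve. all: by end_near. Qed.

(** The constant term is the value at 0; the later coefficients are constant terms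
    of successive derivatives, which vanish identically as well. *)
Lemma pseries_eq0 a : (forall t, pseries a t @ \oo --> 0) -> forall n, a n = 0.
Proof.
move=> a0 n; elim: n a a0 => [|n IH] a a0.
  by have /cvg_lim <- := a0 0; rewrite ?pseries_at0.
have ca t : cvgn (pseries a t) by apply/cvg_ex; exists 0; exact: a0.
suff /IH : forall t, pseries (pseries_diffs a) t @ \oo --> 0.
  by move=> /eqP; rewrite mulf_eq0 pnatr_eq0 => /eqP.
move=> t; have cda := is_cvg_pseries_diffs ca (t := t).
suff <- : limn (pseries (pseries_diffs a) t) = 0 by [].
have [_ <-] := is_derive_pseries t ca.
rewrite (_ : (fun t => _) = cst 0) ?derive_cst//.
by apply/funext => u; apply/cvg_lim => //; exact: a0.
Unshelve. all: by end_near. Qed.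

Variable H : nat -> {poly R}.
Hypothesis hH : hermite_polys H.

(** With this normalization the generating function is a plain power series. *)
Definition nhermite n : {poly R} := (n`!%:R)^-1 *: H n.

Lemma pseries_hermite x t :
  pseries (fun n => (nhermite n).[x]) t @ \oo --> expR (2 * x * t - t ^+ 2).
Proof.
rewrite (_ : pseries _ t = series (fun n => t ^+ n / n`!%:R * (H n).[x])).
  exact: hH.
apply/funext => n; rewrite /pseries /series/=; apply: eq_bigr => i _.
by rewrite /nhermite hornerZ; ring.
Qed.

Lemma nhermite0 : nhermite 0 = 1.
Proof.
suff h x : (nhermite 0).[x] = 1.
  apply/eqP; rewrite -subr_eq0; apply/eqP/poly_eq0_nat => x.
  by rewrite hornerD hornerN h hornerC subrr.
have /cvg_lim := @pseries_hermite x 0.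
rewrite mulr0 expr0n subr0 expR0 => <- //.
by rewrite pseries_at0.
Qed.

Lemma is_derive_hermite_gen x t : is_derive t (1 : R)
  (fun t => expR (2 * x * t - t ^+ 2)) ((2 * x - 2 * t) * expR (2 * x * t - t ^+ 2)).
Proof.
have -> : (fun t => expR (2 * x * t - t ^+ 2)) =
    expR \o ((fun t => 2 * x * t) - (fun t => t ^+ 2)) by [].
apply: is_derive_eq.
rewrite /= /GRing.scale/=; ring.
Qed.

(** The generating function E satisfies E' = (2 x - 2 t) E; compare coefficients. *)
Lemma nhermiteS n : n.+1%:R *: nhermite n.+1 =
  2 *: ('X * nhermite n) - (if n is m.+1 then 2 *: nhermite m else 0).
Proof.
suff h x : (n.+1%:R *: nhermite n.+1 - (2 *: ('X * nhermite n) -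
    (if n is m.+1 then 2 *: nhermite m else 0))).[x] = 0.
  by apply/eqP; rewrite -subr_eq0; apply/eqP/poly_eq0_nat.
pose a k := (nhermite k).[x]; pose f t := expR (2 * x * t - t ^+ 2).
have af t : pseries a t @ \oo --> f t by exact: pseries_hermite.
have ca t : cvgn (pseries a t) by apply/cvg_ex; exists (f t).
pose am k : R := if k is j.+1 then a j else 0.
(* The coefficients of E' - 2 x E + 2 t E. *)
pose b k := pseries_diffs a k - 2 * x * a k + 2 * am k.
have -> : (n.+1%:R *: nhermite n.+1 - (2 *: ('X * nhermite n) -
    (if n is m.+1 then 2 *: nhermite m else 0))).[x] = b n.
  by rewrite /b /pseries_diffs /am /a; case: n => [|n]; rewrite !hornerE; ring.
apply: pseries_eq0 => t.
have daf : pseries (pseries_diffs a) t @ \oo --> (2 * x - 2 * t) * f t.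
  suff <- : limn (pseries (pseries_diffs a) t) = (2 * x - 2 * t) * f t.
    exact: is_cvg_pseries_diffs.
  have [_ <-] := is_derive_pseries t ca.
  rewrite (_ : (fun t => _) = f); first by have [] := is_derive_hermite_gen x t.
  by apply/funext => u; apply/cvg_lim => //; exact: af.
have saf : (fun k => t * pseries a t k.-1) @ \oo --> t * f t.
  apply: cvgM; first exact: cvg_cst.
  by rewrite -cvg_shiftS; exact: af.
have -> : 0 = (2 * x - 2 * t) * f t - 2 * x * f t + 2 * (t * f t) by ring.
have -> : pseries b t = (fun k => pseries (pseries_diffs a) t k -
    2 * x * pseries a t k + 2 * (t * pseries a t k.-1)).
  apply/funext => k; rewrite /pseries /series /=.
  have -> : t * (\sum_(0 <= i < k.-1) a i * t ^+ i) =
      \sum_(0 <= i < k) am i * t ^+ i.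
    case: k => [|k]; first by rewrite !big_geq// mulr0.
    rewrite big_nat_recl// [am 0%N]/= mul0r add0r mulr_sumr; apply: eq_bigr => i _.
    by rewrite exprS mulrCA.
  rewrite !mulr_sumr -sumrB -big_split/=; apply: eq_bigr => i _.
  by rewrite /b; ring.
apply: cvgD; last by apply: cvgM; [exact: cvg_cst|].
by apply: cvgB => //; apply: cvgM; [exact: cvg_cst|exact: af].
Qed.

End HermiteRecurrence.

(** * Orthogonal polynomials over an algebra with involution *)

Lemma size_deriv_leq (A : nzRingType) (Q : {poly A}) : (size Q^`() <= (size Q).-1)%N.
Proof.
have [->|Q0] := eqVneq Q 0; first by rewrite deriv0 size_poly0.
by rewrite -ltnS prednK ?size_poly_gt0// lt_size_deriv.
Qed.

Section MomentFunctional.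
Variables (F : numFieldType) (A : algType F) (m : nat -> F).
Implicit Types (P Q : {poly A}) (a : A).

(** The values m k play the role of the moments of a measure, so that this is the
    integral of a polynomial with coefficients in A. *)
Definition moment Q : A := \sum_(k < size Q) m k *: Q`_k.

Lemma momentE n Q : (size Q <= n)%N -> moment Q = \sum_(k < n) m k *: Q`_k.
Proof.
move=> Qn; rewrite /moment (big_ord_widen n (fun k => m k *: Q`_k) Qn).
rewrite big_mkcond; apply: eq_bigr => k _; case: ltnP => // Qk.
by rewrite nth_default ?scaler0.
Qed.

Fact moment_is_zmod_morphism : zmod_morphism moment.
Proof.
move=> P Q; pose n := maxn (size P) (size Q).
rewrite (@momentE n (P - Q)); last first.
  by rewrite (leq_trans (size_polyD _ _))// size_polyN.
rewrite (@momentE n P) ?leq_maxl// (@momentE n Q) ?leq_maxr//.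
by rewrite -sumrB; apply: eq_bigr => k _; rewrite coefB scalerBr.
Qed.

HB.instance Definition _ :=
  GRing.isZmodMorphism.Build {poly A} A moment moment_is_zmod_morphism.

Lemma momentCM a Q : moment (a%:P * Q) = a * moment Q.
Proof.
rewrite (@momentE (size Q)) ?mulr_sumr; last first.
  by rewrite mul_polyC; exact: size_scale_leq.
by apply: eq_bigr => k _; rewrite coefCM scalerAr.
Qed.

Lemma momentMC a Q : moment (Q * a%:P) = moment Q * a.
Proof.
rewrite (@momentE (size Q)) ?mulr_suml; last first.
  by apply/leq_sizeP => j Qj; rewrite coefMC nth_default// mul0r.
by apply: eq_bigr => k _; rewrite coefMC scalerAl.
Qed.

Hypothesis momentS : forall k, m k.+1 *+ 2 = m k.-1 *+ k.

(** Integration by parts for the weight exp(- x^2), expressed by its moments. *)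
Lemma moment_ibp Q : moment (Q^`()) = moment ('X * Q) *+ 2.
Proof.
have [n Qn] : exists n, (size Q <= n.+1)%N by exists (size Q).
have Qn' := leq_trans (size_deriv_leq Q) (leq_trans (leq_pred _) Qn).
rewrite (momentE Qn') -commr_polyX (@momentE n.+2); last first.
  have [->|Q0] := eqVneq Q 0; first by rewrite mul0r size_poly0.
  by rewrite size_mulX.
rewrite [in RHS]big_ord_recl coefMX scaler0 add0r -sumrMnl.
under [RHS]eq_bigr do rewrite coefMX /= scalerMnl momentS.
rewrite big_ord_recr [RHS]big_ord_recl/= mulr0n scale0r add0r.
rewrite coef_deriv [Q`_n.+1]nth_default// mul0rn scaler0 addr0.
by apply: eq_bigr => i _; rewrite coef_deriv -scalerMnr scalerMnl.
Qed.

End MomentFunctional.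

Section Involution.
Variables (A : nzRingType) (st : {additive A -> A}).
Hypothesis stM : forall a b, st (a * b) = st b * st a.
Hypothesis stK : involutive st.
Implicit Types (P Q : {poly A}) (a : A).

Local Notation pst := (map_poly st).

Lemma coef_pst Q i : (pst Q)`_i = st Q`_i.
Proof. by rewrite coef_map. Qed.

Lemma pstK : involutive pst.
Proof. by move=> Q; apply/polyP => i; rewrite !coef_pst stK. Qed.

Lemma size_pst Q : size (pst Q) = size Q.
Proof. by rewrite size_map_inj_poly ?raddf0//; exact: inv_inj. Qed.

Lemma st1 : st 1 = 1.
Proof. by rewrite -[LHS]mulr1 -[X in _ * X]stK -stM mulr1 stK. Qed.

Lemma pstM P Q : pst (P * Q) = pst Q * pst P.
Proof.
apply/polyP => i; rewrite coef_pst coefM coefMr raddf_sum.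
by apply: eq_bigr => j _; rewrite stM !coef_pst.
Qed.

Lemma pstC a : pst a%:P = (st a)%:P.
Proof. exact: map_polyC. Qed.

Lemma pstX : pst 'X = 'X.
Proof. by apply/polyP => i; rewrite coef_pst !coefX; case: eqP; rewrite ?st1 ?raddf0. Qed.

Lemma pst_deriv Q : pst Q^`() = (pst Q)^`().
Proof. by apply/polyP => i; rewrite coef_pst !coef_deriv raddfMn coef_pst. Qed.

End Involution.

Section Orthogonality.
Variables (F : numFieldType) (A : algType F) (m : nat -> F) (st : {additive A -> A}).
Hypothesis momentS : forall k, m k.+1 *+ 2 = m k.-1 *+ k.
Hypothesis stM : forall a b, st (a * b) = st b * st a.
Hypothesis stK : involutive st.
Hypothesis stm : forall k a, st (m k *: a) = m k *: st a.
Implicit Types (P Q w : {poly A}) (a : A).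

Local Notation mom := (moment m).
Local Notation pst := (map_poly st).

Lemma moment_pst Q : mom (pst Q) = st (mom Q).
Proof.
rewrite /moment size_pst// raddf_sum; apply: eq_bigr => k _.
by rewrite coef_pst stm.
Qed.

(** The matrix-valued inner product for the weight w; coefficients of the
    first argument come out on the left, those of the second on the right after
    applying st. *)
Definition ip w P Q : A := mom (P * w * pst Q).

Fact ip_is_zmod_morphism w P : zmod_morphism (ip w P).
Proof. by move=> Q1 Q2; rewrite /ip raddfB mulrBr raddfB. Qed.
HB.instance Definition _ w P :=
  GRing.isZmodMorphism.Build {poly A} A (ip w P) (ip_is_zmod_morphism w P).

Fact ipr_is_zmod_morphism w Q : zmod_morphism ((ip w)^~ Q).
Proof. by move=> P1 P2; rewrite /ip !mulrBl raddfB. Qed.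

Lemma ipBl w P1 P2 Q : ip w (P1 - P2) Q = ip w P1 Q - ip w P2 Q.
Proof. exact: ipr_is_zmod_morphism. Qed.

Lemma ipCl w a P Q : ip w (a%:P * P) Q = a * ip w P Q.
Proof. by rewrite /ip -!mulrA momentCM. Qed.

Lemma ipCr w a P Q : ip w P (a%:P * Q) = ip w P Q * st a.
Proof. by rewrite /ip pstM// pstC mulrA momentMC. Qed.

Lemma ipX w P Q : ip w ('X * P) Q = ip w P ('X * Q).
Proof. by rewrite /ip pstM// pstX// [in RHS]mulrA commr_polyX !mulrA. Qed.

Definition monic_ops w (P : nat -> {poly A}) :=
  forall n, [/\ P n \is monic, size (P n) = n.+1 &
    forall Q, (size Q <= n)%N -> ip w (P n) Q = 0].

(** Q differs from its term of degree n by a polynomial of smaller degree. *)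
Lemma ip_lead w P n Q : (forall Q', (size Q' <= n)%N -> ip w P Q' = 0) ->
  (size Q <= n.+1)%N -> ip w P Q = ip w P 'X^n * st Q`_n.
Proof.
move=> P0 Qn; rewrite -ipCr; apply/eqP; rewrite -subr_eq0 -raddfB; apply/eqP.
apply: P0; apply/leq_sizeP => j; rewrite leq_eqVlt => /predU1P[<-|nj].
  by rewrite coefB coefCM coefXn eqxx mulr1 subrr.
rewrite coefB coefCM coefXn gtn_eqF// mulr0 subr0 nth_default//.
exact: leq_trans Qn nj.
Qed.

Section Pearson.
Variables (w0 w1 Phi Psi : {poly A}).
Hypotheses (w0st : pst w0 = w0) (w1st : pst w1 = w1).
Hypotheses (w1E : w1 = Phi * w0) (dw1E : w1^`() - ('X * w1) *+ 2 = Psi * w0).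

(** Integration by parts.  As the weights are self-adjoint, the Pearson equations
    also hold with the adjoint factors on the right of w0, where they can be
    moved to the second argument. *)
Lemma ip_deriv P Q :
  ip w1 P^`() Q = - ip w0 P (Q^`() * Phi + Q * Psi).
Proof.
have w1E' : w1 = w0 * pst Phi by rewrite -w1st w1E pstM// w0st.
have dw1E' : w1^`() - ('X * w1) *+ 2 = w0 * pst Psi.
  rewrite -w0st -pstM// -dw1E raddfB /= [map_poly st (_ *+ 2)]raddfMn /= pst_deriv.
  by rewrite pstM// pstX// w1st commr_polyX.
apply/eqP; rewrite -addr_eq0 /ip raddfD /= !pstM// mulrDr.
rewrite -[P * w0 * (_ * pst _)]mulrA [w0 * (pst Phi * _)]mulrA -w1E'.
rewrite -[P * w0 * (_ * pst _)]mulrA [w0 * (pst Psi * _)]mulrA -dw1E'.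
have := moment_ibp momentS (P * w1 * pst Q).
rewrite !derivM -[mom _ *+ 2]raddfMn => /eqP; rewrite -subr_eq0 -raddfB => /eqP mom0.
rewrite -raddfD; apply/eqP; rewrite -[RHS]mom0; congr mom.
have -> : 'X * (P * w1 * pst Q) *+ 2 = P * ('X * w1 *+ 2) * pst Q.
  by rewrite mulrnAr mulrnAl !mulrA commr_polyX.
by rewrite pst_deriv !mulrA mulrBr mulrBl mulrDl -!addrA [X in _ + X]addrCA.
Qed.

(** The left-hand side of the second Pearson equation has integral 0. *)
Lemma moment_XsubC kappa b : GRing.lreg kappa ->
  Psi = - (kappa%:P * ('X - b%:P)) -> mom ('X * w0) = b * mom w0.
Proof.
move=> kr PsiE; apply/eqP; rewrite -subr_eq0 -momentCM -raddfB/= -mulrBl.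
apply/eqP/kr; rewrite mulr0 -momentCM mulrA -[_ * _ * _]opprK -mulNr -PsiE -dw1E.
by rewrite raddfN raddfB/= raddfMn/= moment_ibp// subrr oppr0.
Qed.

End Pearson.

Definition deriv_ops (P : nat -> {poly A}) n : {poly A} :=
  (n.+1%:R^-1%:A)%:P * (P n.+1)^`().

Section DerivedFamily.
Variables (w0 w1 Phi Psi : {poly A}) (P : nat -> {poly A}).
Hypotheses (w0st : pst w0 = w0) (w1st : pst w1 = w1).
Hypotheses (w1E : w1 = Phi * w0) (dw1E : w1^`() - ('X * w1) *+ 2 = Psi * w0).
Hypotheses (sPhi : (size Phi <= 2)%N) (sPsi : (size Psi <= 2)%N).
Hypothesis opsP : monic_ops w0 P.

Lemma coef_deriv_ops n i : (deriv_ops P n)`_i = (i.+1%:R / n.+1%:R) *: (P n.+1)`_i.+1.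
Proof.
rewrite coefCM coef_deriv mulr_algl -[_`__ *+ i.+1](@scaler_nat F) scalerA.
by rewrite mulrC.
Qed.

Lemma size_pearson Q n : (size Q <= n)%N ->
  (size (Q^`() * Phi + Q * Psi)%R <= n.+1)%N.
Proof.
move=> Qn; rewrite (leq_trans (size_polyD _ _))// geq_max.
rewrite !(leq_trans (size_polyMleq _ _))// -[n.+1]/(n.+2.-1) -!subn1 leq_sub2r//.
  by rewrite -[n.+2]addn2 leq_add.
rewrite -[n.+2]addn2 leq_add// (leq_trans (size_deriv_leq Q))//.
by rewrite (leq_trans (leq_pred _)).
Qed.

(** Moving the derivative to the other argument raises its degree by at most one. *)
Lemma deriv_ops_monic_ops : monic_ops w1 (deriv_ops P).
Proof.
move=> n; have [mP sP oP] := opsP n.+1.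
have c1 : (deriv_ops P n)`_n = 1.
  rewrite coef_deriv_ops divff ?pnatr_eq0// scale1r.
  by move: mP; rewrite monicE lead_coefE sP => /eqP.
have sd : size (deriv_ops P n) = n.+1.
  apply/eqP; rewrite eqn_leq; apply/andP; split.
    apply/leq_sizeP => j nj; rewrite coef_deriv_ops nth_default ?scaler0// sP.
    by rewrite ltnS.
  by rewrite ltnNge; apply/negP => /leq_sizeP/(_ n (leqnn n))/eqP; rewrite c1 oner_eq0.
split=> //; first by rewrite monicE lead_coefE sd c1.
move=> Q Qn; rewrite ipCl (ip_deriv w0st w1st w1E dw1E) oP ?oppr0 ?mulr0//.
exact: size_pearson.
Qed.

(** The term with Phi drops out because its degree is too small, and from Psi only
    the leading coefficient contributes. *)
Lemma ip_deriv_ops n :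
  ip w1 (deriv_ops P n) 'X^n *+ n.+1 = - (ip w0 (P n.+1) 'X^(n.+1) * st Psi`_1).
Proof.
have [_ _ oP] := opsP n.+1.
rewrite ipCl mulr_algl -[_ *: _ *+ _](@scaler_nat F) scalerA mulfV ?pnatr_eq0// scale1r.
rewrite (ip_deriv w0st w1st w1E dw1E); congr (- _).
rewrite (ip_lead oP) ?size_pearson ?size_polyXn//; congr (_ * st _).
rewrite coefD coefXnM ltnNge leqnSn subSnn [X in X + _]nth_default ?add0r//.
rewrite (leq_trans (size_polyMleq _ _))// -[n.+1]/(n.+2.-1) -!subn1 leq_sub2r//.
by rewrite -[n.+2]addn2 leq_add// (leq_trans (size_deriv_leq _))// size_polyXn.
Qed.

End DerivedFamily.

Section Recurrence.
Variables (w Phi Psi : nat -> {poly A}) (kappa b e : nat -> A).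
Hypotheses (wst : forall k, pst (w k) = w k).
Hypotheses (wS : forall k, w k.+1 = Phi k * w k).
Hypotheses (dwS : forall k, (w k.+1)^`() - ('X * w k.+1) *+ 2 = Psi k * w k).
Hypothesis sPhi : forall k, (size (Phi k) <= 2)%N.
Hypothesis PsiE : forall k, Psi k = - ((kappa k)%:P * ('X - (b k)%:P)).
Hypothesis kappa_st : forall k, st (kappa k) = kappa k.
Hypothesis kappa_lreg : forall k, GRing.lreg (kappa k).
Hypothesis kappa_rreg : forall k, GRing.rreg (kappa k).
Hypothesis eE : forall k, e k * mom (w k) * kappa k = mom (w k.+1).
Hypothesis ip_def : forall k P, ip (w k) P P = 0 -> P = 0.

Lemma coef_Psi k : (Psi k)`_1 = - kappa k.
Proof. by rewrite PsiE coefN coefCM coefB coefX coefC subr0 mulr1. Qed.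

Lemma size_Psi k : (size (Psi k) <= 2)%N.
Proof.
rewrite PsiE size_polyN (leq_trans (size_polyMleq _ _))// size_XsubC addn2 /=.
by rewrite ltnS size_polyC leq_b1.
Qed.

(** If a is in the left kernel of the total mass then the constant polynomial a has
    norm 0. *)
Lemma moment_w_rreg k : GRing.rreg (mom (w k)).
Proof.
apply: mulIr0_rreg => a aM.
have : ip (w k) a%:P a%:P = 0.
  by rewrite /ip pstC momentMC momentCM aM mul0r.
by move/ip_def/eqP; rewrite polyC_eq0 => /eqP.
Qed.

Lemma ip_XsubC k : ip (w k) ('X - (b k)%:P) 1 = 0.
Proof.
rewrite /ip map_polyC/= st1// mulr1 mulrBl raddfB/= momentCM.
by rewrite (moment_XsubC (dwS k) (@kappa_lreg k) (PsiE k)) subrr.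
Qed.

Lemma monic_ops0 v (Q : nat -> {poly A}) : monic_ops v Q -> Q 0 = 1.
Proof.
move=> /(_ 0)[+ + _]; rewrite monicE lead_coefE => + sQ; rewrite sQ => /eqP mQ.
by rewrite (size1_polyC (eq_leq sQ)) mQ.
Qed.

Lemma ip11 v : ip v 1 1 = mom v.
Proof. by rewrite /ip map_polyC/= st1// mulr1 mul1r. Qed.

Variable P : nat -> {poly A}.
Hypothesis opsP : monic_ops (w 0) P.

Lemma iter_deriv_ops k : monic_ops (w k) (iter k deriv_ops P).
Proof.
elim: k => //= k IH.
exact: deriv_ops_monic_ops (wst k) (wst k.+1) (wS k) (dwS k) (sPhi k) (size_Psi k) IH.
Qed.

Lemma coef_iter_deriv_ops k n :
  (iter k deriv_ops P n.+1)`_n = (n.+1%:R / (n.+1 + k)%:R) *: (P (n.+1 + k)%N)`_(n + k).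
Proof.
elim: k n => [|k IH] n; first by rewrite !addn0 divff ?pnatr_eq0// scale1r.
rewrite /= coef_deriv_ops IH scalerA -!addSnnS; congr (_ *: _).
by rewrite mulrA divfK ?pnatr_eq0.
Qed.

(** The n-th derivative of P (n+1), once normalized, is the monic orthogonal
    polynomial of degree 1 for w n; so is 'X - b n. *)
Lemma coef_sublead n : (P n.+1)`_n = - b n *+ n.+1.
Proof.
have [mQ sQ oQ] := iter_deriv_ops n 1.
have := coef_iter_deriv_ops n 0; rewrite add0n add1n.
set Q := iter _ _ _ _ in mQ sQ oQ * => c0.
have QE : Q = 'X + (Q`_0)%:P.
  apply/polyP => -[|[|i]]; rewrite coefD coefX coefC/= ?add0r//.
    by rewrite addr0; move: mQ; rewrite monicE lead_coefE sQ => /eqP.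
  by rewrite nth_default// sQ.
have : ip (w n) Q 1 - ip (w n) ('X - (b n)%:P) 1 = 0.
  by rewrite ip_XsubC oQ ?subr0// size_polyC oner_eq0.
rewrite -ipBl {1}QE.
have -> : 'X + (Q`_0)%:P - ('X - (b n)%:P) = (Q`_0 + b n)%:P * 1.
  by rewrite mulr1 polyCD opprB addrC addrA subrK addrC.
rewrite ipCl ip11 -[X in _ = X](mul0r (mom (w n))) => /(@moment_w_rreg n).
move=> /eqP; rewrite addr_eq0 c0 => /eqP <-.
rewrite -[_ *: _ *+ _](@scaler_nat F) scalerA mul1r mulfV ?pnatr_eq0// scale1r//.
Qed.

(** One differentiation trades the norm of degree n + 2 for w k against the norm of
    degree n + 1 for w (k+1), which by induction on n involves the same e. *)
Lemma ip_lead_rec k n :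
  ip (w k) (iter k deriv_ops P n.+1) 'X^(n.+1) =
  e (k + n)%N * ip (w k) (iter k deriv_ops P n) 'X^n *+ n.+1.
Proof.
(* The identity of ip_deriv_ops along the family of weights. *)
have key k' n' : ip (w k'.+1) (iter k'.+1 deriv_ops P n') 'X^n' *+ n'.+1 =
    ip (w k') (iter k' deriv_ops P n'.+1) 'X^(n'.+1) * kappa k'.
  rewrite (ip_deriv_ops (wst k') (wst k'.+1) (wS k') (dwS k') (sPhi k')
    (size_Psi k') (iter_deriv_ops k')).
  by rewrite coef_Psi raddfN mulrN opprK kappa_st.
elim: n k => [|n IH] k; apply: (@kappa_rreg k).
  rewrite -key addn0 !mulr1n (monic_ops0 (iter_deriv_ops k.+1)).
  by rewrite (monic_ops0 (iter_deriv_ops k)) !ip11 eE.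
by rewrite mulrnAl -mulrA -!key IH addSnnS mulrnAr.
Qed.

Theorem three_term_recurrence n :
  'X * P n = P n.+1 + (b n *+ n.+1 - b n.-1 *+ n)%:P * P n
    + (e n.-1 *+ n)%:P * (if n is n'.+1 then P n' else 0).
Proof.
have [mP sP oP] := opsP n; have [mP1 sP1 oP1] := opsP n.+1.
set B := b n *+ _ - _; set P' := if n is _.+1 then _ else _.
have sP' : (size P' <= n)%N.
  rewrite /P'; case: n {mP sP oP mP1 sP1 oP1 B P'} => [|n]; rewrite ?size_poly0//.
  by have [_ -> _] := opsP n.
pose D := 'X * P n - P n.+1 - B%:P * P n - (e n.-1 *+ n)%:P * P'.
have lP k : (P k)`_k = 1.
  by have [+ s _] := opsP k; rewrite monicE lead_coefE s => /eqP.
(* B and the choice of leading terms remove the coefficients n and n + 1. *)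
have sD : (size D <= n)%N.
  apply/leq_sizeP => j; rewrite /D !coefB !coefCM coefXM.
  rewrite leq_eqVlt => /predU1P[<-|nj]; last first.
    rewrite [P'`_j]nth_default ?mulr0 ?subr0; last exact: leq_trans sP' (ltnW nj).
    case: j nj => // j; rewrite ltnS leq_eqVlt => /predU1P[<-|nj] /=.
      by rewrite !lP subrr [(P n)`_n.+1]nth_default ?sP// mulr0 subr0.
    by rewrite !nth_default ?mulr0 ?subr0 ?sP ?sP1// ltnW.
  rewrite [P'`_n]nth_default// mulr0 subr0 lP mulr1 coef_sublead /B.
  case: n {mP sP oP mP1 sP1 oP1 P' sP' D B} => [|n] /=.
    by rewrite sub0r mulr0n subr0 mulNrn opprK subrr.
  by rewrite coef_sublead !mulNrn opprK [- _ + _]addrC subrr.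
suff /ip_def D0 : ip (w 0) D D = 0.
  apply/eqP; rewrite -subr_eq0 -[X in _ == X]D0 /D.
  by rewrite !opprD !addrA.
case: n => [|n] in mP sP oP mP1 sP1 oP1 B P' sP' D sD *.
  by move: sD; rewrite leqn0 size_poly_eq0 => /eqP ->; rewrite raddf0.
have DE Q : (size Q <= n.+1)%N ->
    ip (w 0) D Q = ip (w 0) (P n.+1) ('X * Q) - e n *+ n.+1 * ip (w 0) (P n) Q.
  move=> Qn; rewrite /D !ipBl !ipCl ipX oP1 ?subr0; last exact: leqW.
  by rewrite [ip _ _ Q]oP// mulr0 subr0.
have [_ _ oPn] := opsP n.
rewrite (@ip_lead _ _ n)// => [|Q Qn]; last first.
  rewrite DE ?(leqW Qn)// oPn// mulr0 subr0 oP//.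
  have [->|Q0] := eqVneq Q 0; first by rewrite mulr0 size_poly0.
  by rewrite -commr_polyX size_mulX.
(* The coefficient of P' was chosen so that D is orthogonal to 'X^n too. *)
rewrite DE ?size_polyXn// -exprS (ip_lead_rec 0 n) mulrnAl subrr.
by rewrite mul0r.
Qed.

End Recurrence.
End Orthogonality.

(** * Polynomial expressions in a nilpotent element *)

Section NilpotentSum.
Variables (B : nzRingType) (x s J f cN : B) (g : nat -> B) (N : nat).
Hypothesis x_central : forall u, u * x = x * u.
Hypothesis g_central : forall j u, u * g j = g j * u.
Hypothesis gS : forall j,
  g j.+1 *+ j.+1 = (x * g j - (if j is i.+1 then g i else 0)) *+ 2.
Hypothesis sN : s ^+ N = 0.
Hypothesis sJ : s * J = J * s - s.
Hypothesis sf : s * f = f * s + (J *+ 2 - cN).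
Hypothesis cN_central : forall u, u * cN = cN * u.

(** For g j = H_j / j! this is exp(2 x s - s^2), a finite sum because s is
    nilpotent.  The term j = N vanishes; it is kept so that differentiating in s
    shifts the coefficients without a boundary term. *)
Definition nilp_sum : B := \sum_(j < N.+1) g j * s ^+ j.
(** The formal derivative of nilp_sum with respect to s. *)
Definition nilp_sum_deriv : B := \sum_(j < N.+1) g j.+1 *+ j.+1 * s ^+ j.

Lemma nilp_sum_comm : s * nilp_sum = nilp_sum * s.
Proof.
rewrite mulr_sumr mulr_suml; apply: eq_bigr => j _.
by rewrite mulrA g_central -!mulrA -exprS exprSr.
Qed.

(** The derivative of exp(2 x s - s^2) in s. *)
Lemma nilp_sum_derivE : nilp_sum_deriv = (x - s) * nilp_sum *+ 2.
Proof.
rewrite /nilp_sum_deriv; under eq_bigr do rewrite gS mulrnAl mulrBl.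
rewrite sumrMnl sumrB mulrBl; congr ((_ - _) *+ 2).
  by rewrite mulr_sumr; apply: eq_bigr => j _; rewrite mulrA.
rewrite /nilp_sum big_ord_recl mul0r add0r big_ord_recr/= sN mulr0 addr0 mulr_sumr.
by apply: eq_bigr => j _; rewrite mulrA g_central -mulrA -exprS.
Qed.

Lemma exprMJ j : s ^+ j * J = (J - j%:R) * s ^+ j.
Proof.
elim: j => [|j IH]; first by rewrite expr0 mul1r subr0 mulr1.
rewrite exprS -mulrA IH mulrA mulrBr sJ -natr1 opprD addrA.
rewrite mulr_natr -mulr_natl [RHS]mulrA; congr (_ * _).
by rewrite !mulrBl mul1r addrAC.
Qed.

(** The relation of a lowering and a raising operator of sl2, whose Cartan element
    is here J *+ 2 - cN. *)
Lemma exprMf j :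
  s ^+ j.+1 * f = f * s ^+ j.+1 + (J *+ 2 - cN - j%:R) *+ j.+1 * s ^+ j.
Proof.
set h := J *+ 2 - cN.
have sh : s * h = (h - 2) * s.
  by rewrite /h mulrBr mulrnAr sJ cN_central !mulrBl !mulrnAl mul1r mulrnBl addrAC.
elim: j => [|j IH]; first by rewrite !expr1 expr0 subr0 mulr1.
rewrite exprS -mulrA IH mulrDr mulrA sf mulrDl -[f * s * _]mulrA -exprS -addrA.
rewrite -/h [s * (_ * _)]mulrA mulrnAr mulrBr sh mulr_natr -[s *+ j]mulr_natl.
rewrite -mulrBl -mulrnAl -mulrA -exprS -mulrDl; congr (_ + _ * _).
move: h {sh IH} => h.
have -> : h - 2 - j%:R = h - j.+2%:R by rewrite -addrA -opprD -natrD.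
rewrite !mulrnBl -[j.+2%:R *+ _]mulr_natr -[j.+1%:R *+ _]mulr_natr -!natrM.
by rewrite addrA -mulrS mulnC.
Qed.

(** The commutator of s ^+ j with J is - j s ^+ j, and j s^j is s times the derivative
    of s^j. *)
Lemma nilp_sum_J : nilp_sum * J = J * nilp_sum - s * nilp_sum_deriv.
Proof.
rewrite /nilp_sum /nilp_sum_deriv mulr_suml mulr_sumr.
rewrite [X in s * X]big_ord_recr/= sN mulr0 addr0 mulr_sumr.
have -> : \sum_(j < N) s * (g j.+1 *+ j.+1 * s ^+ j) =
    \sum_(j < N.+1) g j *+ j * s ^+ j.
  rewrite big_ord_recl mulr0n mul0r add0r; apply: eq_bigr => j _.
  by rewrite mulrnAl mulrnAr mulrA g_central -mulrA -exprS mulrnAl.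
rewrite -sumrB; apply: eq_bigr => j _.
rewrite -mulrA exprMJ mulrBl mulrBr !mulrA; congr (_ - _).
  by rewrite g_central.
by rewrite mulr_natr.
Qed.

(** The commutator with s ^+ j in exprMf has a term of degree two in j.  One factor
    j differentiates the sum and the other is the commutator of J with the
    derivative, whence the two occurrences of nilp_sum_deriv. *)
Lemma nilp_sum_f :
  nilp_sum * f = f * nilp_sum + (J - cN) * nilp_sum_deriv + nilp_sum_deriv * J.
Proof.
have gJ : nilp_sum_deriv * J =
    J * nilp_sum_deriv - \sum_(j < N.+1) g j.+1 *+ j.+1 * (j%:R * s ^+ j).
  rewrite mulr_suml mulr_sumr -sumrB; apply: eq_bigr => j _.
  rewrite -mulrA exprMJ mulrBl mulrBr; congr (_ - _).
  by rewrite !mulrA mulrnAl mulrnAr g_central.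
have -> : nilp_sum * f = f * nilp_sum +
    \sum_(j < N.+1) g j.+1 *+ j.+1 * ((J *+ 2 - cN - j%:R) * s ^+ j).
  rewrite [X in _ + X]big_ord_recr/= sN !mulr0 addr0.
  rewrite mulr_suml big_ord_recl expr0 mulr1 mulr_sumr [in RHS]big_ord_recl.
  rewrite expr0 mulr1 g_central -addrA -big_split/=; congr (_ + _).
  apply: eq_bigr => j _; rewrite -mulrA exprMf mulrDr !mulrA g_central.
  by congr (_ + _ * _); rewrite mulrnAr [RHS]mulrnAl.
rewrite gJ -[RHS]addrA; congr (_ + _).
rewrite addrA -mulrDl [J - cN + J]addrAC -mulr2n mulr_sumr -sumrB.
apply: eq_bigr => j _; rewrite mulrBl mulrBr; congr (_ - _).
by rewrite !mulrA mulrnAl mulrnAr g_central.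
Qed.

End NilpotentSum.

(** * Pearson equations for the weight *)

Section PearsonWeights.
Variables (F : numFieldType) (A : algType F) (st : {additive A -> A}).
Hypothesis stM : forall a b, st (a * b) = st b * st a.
Hypothesis stK : involutive st.
Variables (s J f : A) (h : nat -> {poly F}) (N : nat).
Hypothesis h0 : h 0 = 1.
Hypothesis hS : forall j,
  h j.+1 *+ j.+1 = ('X * h j - (if j is i.+1 then h i else 0)) *+ 2.
Hypothesis sN : s ^+ N = 0.
Hypothesis sJ : s * J = J * s - s.
Hypothesis sf : s * f = f * s + (J *+ 2 - N.+1%:R).

Local Notation pst := (map_poly st).
Local Notation emb := (map_poly (in_alg A)).

Lemma embC p (Q : {poly A}) : Q * emb p = emb p * Q.
Proof.
apply/polyP => i; rewrite coefM coefMr; apply: eq_bigr => j _.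
by rewrite coef_map /= mulr_algl mulr_algr.
Qed.

Lemma emb_gS j : emb (h j.+1) *+ j.+1 =
  ('X * emb (h j) - (if j is i.+1 then emb (h i) else 0)) *+ 2.
Proof.
rewrite -rmorphMn/= hS rmorphMn rmorphB rmorphM/= map_polyX.
by case: j => [|j]; rewrite ?rmorph0.
Qed.

(** That the Hermite polynomials are an Appell sequence follows from their
    three-term recurrence alone. *)
Lemma hderiv j : (h j)^`() = (if j is i.+1 then h i else 0) *+ 2.
Proof.
have h1 : h 1 = 'X *+ 2 by have := hS 0; rewrite h0 mulr1n mulr1 subr0.
suff [] : (h j)^`() = (if j is i.+1 then h i else 0) *+ 2 /\
  (h j.+1)^`() = h j *+ 2 by [].
elim: j => [|j [IH1 IH2]]; first by rewrite h1 h0 derivC mul0rn derivMn derivX.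
split=> //; have /(congr1 (@deriv F)) := hS j.+1.
rewrite !derivMn derivB derivM derivX mul1r IH1 IH2 mulrnAr -addrA -mulrnBl -hS.
rewrite -mulrS mulrnAC => e; apply/polyP => i.
by move/(congr1 (fun p : {poly F} => p`_i)): e; rewrite !coefMn; exact: pmulrnI.
Qed.

Definition Lpoly : {poly A} := nilp_sum s%:P (fun j => emb (h j)) N.

Lemma Lpoly_comm : s%:P * Lpoly = Lpoly * s%:P.
Proof. by apply: nilp_sum_comm => j u; exact: embC. Qed.

Lemma polyC_nilp : s%:P ^+ N = 0 :> {poly A}.
Proof. by rewrite -rmorphXn sN. Qed.

Lemma deriv_Lpoly : Lpoly^`() = s%:P * Lpoly *+ 2.
Proof.
rewrite /Lpoly /nilp_sum raddf_sum/= big_ord_recl big_ord_recr/= polyC_nilp.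
rewrite mulr0 addr0 expr0 mulr1 deriv_map hderiv mul0rn rmorph0 add0r.
rewrite mulr_sumr -sumrMnl; apply: eq_bigr => i _.
rewrite derivM deriv_map hderiv -rmorphXn derivC mulr0 addr0 rmorphMn/= mulrnAl.
by rewrite [(s ^+ _)%:P]rmorphXn /= mulrA embC -mulrA exprS.
Qed.

(** Lpoly is 1 plus a nilpotent element. *)
Lemma Lpoly_rreg : GRing.rreg Lpoly.
Proof.
pose g := \sum_(j < N) emb (h j.+1) * s%:P ^+ j.
have gs : GRing.comm g s%:P.
  rewrite /GRing.comm mulr_suml mulr_sumr; apply: eq_bigr => j _.
  by rewrite mulrA embC -!mulrA -exprS exprSr.
have LE : Lpoly = 1 + g * s%:P.
  rewrite /Lpoly /nilp_sum big_ord_recl expr0 mulr1 h0 rmorph1 mulr_suml.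
  by congr (_ + _); apply: eq_bigr => j _; rewrite -mulrA -exprSr.
apply: mulIr0_rreg => D; rewrite LE mulrDr mulr1 => /eqP; rewrite addr_eq0 => /eqP DE.
(* D (1 + g s) = 0 means D = - D g s, and g s is nilpotent. *)
have DX n : D = D * (- (g * s%:P)) ^+ n.
  by elim: n => [|n IH]; rewrite ?expr0 ?mulr1// exprSr mulrA -IH mulrN -DE.
by rewrite (DX N) exprNn exprMn_comm// polyC_nilp !mulr0.
Qed.

Let cN : {poly A} := N.+1%:R.
Let G := ('X - s%:P) * Lpoly *+ 2.

Lemma natC n (Q : {poly A}) : Q * n%:R = n%:R * Q.
Proof. by rewrite mulr_natr mulr_natl. Qed.

Let sJP : s%:P * J%:P = J%:P * s%:P - s%:P :> {poly A}.
Proof. by rewrite -!polyCM sJ polyCB. Qed.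

Let sfP : s%:P * f%:P = f%:P * s%:P + (J%:P *+ 2 - cN) :> {poly A}.
Proof. by rewrite -!polyCM sf polyCD polyCB polyCMn rmorph_nat. Qed.

Let GE : nilp_sum_deriv s%:P (fun j => emb (h j)) N = G.
Proof.
apply: nilp_sum_derivE => [j u||]; [exact: embC|exact: emb_gS|exact: polyC_nilp].
Qed.

Lemma Lpoly_J : Lpoly * J%:P = J%:P * Lpoly - s%:P * G.
Proof.
rewrite -GE; apply: nilp_sum_J; [|exact: polyC_nilp|exact: sJP].
by move=> j u; exact: embC.
Qed.

Lemma Lpoly_f : Lpoly * f%:P = f%:P * Lpoly + (J%:P - cN) * G + G * J%:P.
Proof.
rewrite -GE; apply: nilp_sum_f;
  [|exact: polyC_nilp|exact: sJP|exact: sfP|].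
by move=> j u; exact: embC.
by move=> u; exact: natC.
Qed.

Definition wpoly (Delta : A) := Lpoly * Delta%:P * pst Lpoly.

Lemma pst_wpoly Delta : st Delta = Delta -> pst (wpoly Delta) = wpoly Delta.
Proof. by move=> sD; rewrite /wpoly !pstM// pstC sD pstK// mulrA. Qed.

Section Step.
Variables (Delta Delta1 b : A) (d r : F).
Hypothesis Delta1E : Delta1 = d *: ((J + r%:A) * Delta).
Hypothesis Delta1s : Delta1 * st s *+ 2 = d *: (f * Delta).
Let K : A := N.+1%:R + r%:A - J.
Hypothesis Kb : K * b *+ 2 = K * s *+ 2 + f.

Definition Phi : {poly A} :=
  (d%:A)%:P * (J%:P - s%:P * ('X - s%:P) *+ 2 + (r%:A)%:P).

Definition Psi : {poly A} := - (((d *: K) *+ 2)%:P * ('X - b%:P)).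

Let algC (c : F) (Q : {poly A}) : Q * (c%:A)%:P = (c%:A)%:P * Q.
Proof. by rewrite -[_%:P](map_polyC (in_alg A)) embC. Qed.

Let scaleP (c : F) (a : A) : (c *: a)%:P = (c%:A)%:P * a%:P :> {poly A}.
Proof. by rewrite -polyCM mulr_algl. Qed.

Let LDelta1 : Lpoly * Delta1%:P =
  (d%:A)%:P * (Lpoly * (J%:P + (r%:A)%:P)) * Delta%:P.
Proof. by rewrite Delta1E scaleP polyCM polyCD mulrA algC -!mulrA. Qed.

Lemma size_Phi : (size Phi <= 2)%N.
Proof.
apply/leq_sizeP => -[|[|i]]// _.
rewrite coefCM !coefD coefN coefMn coefCM coefB coefX !coefC/=.
by rewrite subrr mulr0 mul0rn subr0 addr0 mulr0.
Qed.

Lemma wpoly_step : wpoly Delta1 = Phi * wpoly Delta.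
Proof.
rewrite /wpoly LDelta1 /Phi !mulrA; congr (_ * _ * _).
rewrite -!mulrA; congr (_ * _).
rewrite mulrDr Lpoly_J algC !mulrDl mulNr; congr (_ - _ + _).
by rewrite /G mulrnAr mulrnAl mulrA.
Qed.

(** By Lpoly_f, the derivative of the left factor and the factor - 2 x combine with
    the commutator of Lpoly and f so that only the linear polynomial Psi remains. *)
Lemma wpoly_deriv :
  (wpoly Delta1)^`() - ('X * wpoly Delta1) *+ 2 = Psi * wpoly Delta.
Proof.
have dW : (wpoly Delta1)^`() = (s%:P * (Lpoly * Delta1%:P) * pst Lpoly
    + Lpoly * (Delta1 * st s)%:P * pst Lpoly) *+ 2.
  rewrite /wpoly !derivM derivC mulr0 addr0 deriv_Lpoly -pst_deriv deriv_Lpoly.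
  rewrite Lpoly_comm raddfMn /= pstM// pstC -Lpoly_comm mulrnDl.
  by rewrite !mulrnAl mulrnAr polyCM !mulrA.
(* The two commutators with J hidden in Lpoly_f and in the first Pearson
   equation cancel. *)
have fE : Lpoly * f%:P - G * (J%:P + (r%:A)%:P) = f%:P * Lpoly - K%:P * G.
  rewrite Lpoly_f [G * (_ + _)]mulrDr opprD addrA addrK algC -addrA -mulrBl.
  congr (_ + _); rewrite -mulNr; congr (_ * _).
  by rewrite /K polyCB polyCD rmorph_nat opprB opprD addrA addrAC.
have fK : f%:P = K%:P * (b%:P - s%:P) *+ 2.
  rewrite -polyCB -polyCM -polyCMn mulrBr mulrnBl Kb.
  by rewrite addrAC subrr add0r.
have PsiL : Psi * Lpoly = (d%:A)%:P * (f%:P * Lpoly - K%:P * G).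
  rewrite fK /G mulrnAr mulrnAl -mulrnBl mulrA -mulrBl -mulrBr opprB addrA subrK.
  rewrite /Psi polyCMn scaleP -[b%:P - _]opprB [_ * - _ in RHS]mulrN.
  rewrite [- _ * Lpoly in RHS]mulNr mulNrn [RHS]mulrN [LHS]mulNr; congr (- _).
  by rewrite mulrnAr !mulrnAl !mulrA.
rewrite dW /wpoly [RHS]mulrA [Psi * _]mulrA PsiL -fE mulrnDl.
have -> : Lpoly * (Delta1 * st s)%:P * pst Lpoly *+ 2 =
    (d%:A)%:P * (Lpoly * f%:P) * Delta%:P * pst Lpoly.
  rewrite -mulrnAl -mulrnAr -polyCMn Delta1s scaleP polyCM !mulrA; congr (_ * _ * _ * _).
  by rewrite algC.
have GD : (d%:A)%:P * (G * (J%:P + (r%:A)%:P)) * Delta%:P =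
    ('X - s%:P) * (Lpoly * Delta1%:P) *+ 2.
  rewrite LDelta1 /G mulrnAl mulrnAr mulrnAl; congr (_ *+ 2).
  by rewrite !mulrA algC.
rewrite addrAC -mulrnBl addrC ['X * (_ * _)]mulrA -mulrBl -mulrBl.
rewrite -[s%:P - 'X]opprB [- _ * _]mulNr [- _ * _]mulNr mulNrn -mulrnAl -GD.
by rewrite mulrBr !mulrBl.
Qed.

(** When b is the mean of v, its first moment is expressed by its mass. *)
Lemma moment_Phi (m : nat -> F) (v : {poly A}) :
  moment m ('X * v) = b * moment m v ->
  moment m (Phi * v) = d *: ((J + r%:A - s * (b - s) *+ 2) * moment m v).
Proof.
move=> mX; rewrite /Phi -mulrA momentCM mulr_algl; congr (_ *: _).
rewrite [J + r%:A - _]addrAC.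
rewrite [in RHS]mulrDl [in RHS]mulrBl [in LHS]mulrDl [in LHS]mulrBl raddfD raddfB/=.
rewrite !momentCM; congr (_ - _ + _).
rewrite !mulrnAl raddfMn /= -mulrA momentCM -mulrA mulrBl raddfB/= mX momentCM.
by rewrite mulrBl.
Qed.

End Step.
End PearsonWeights.

(** * Matrix-valued Gaussian integrals as moments *)

Local Open Scope complex_scope.
Local Open Scope sesquilinear_scope.

Section MatrixMoments.
Variables (R : realType) (N' : nat).
Local Notation C := R[i].
Local Notation A := 'M[C]_N'.+1.
Implicit Types (Q : {poly A}) (M : A).

Definition cmoment k : C := (gauss_moment k : R)%:C.

Lemma cmomentS k : cmoment k.+1 *+ 2 = cmoment k.-1 *+ k.
Proof. by rewrite /cmoment -!rmorphMn/= gauss_momentS. Qed.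

(** A name for the conjugate transpose on which its additive structure can be
    declared. *)
Definition ctr (M : A) : A := M^t*.

Fact ctr_is_zmod_morphism : zmod_morphism ctr.
Proof. by move=> M1 M2; apply/matrixP => i j; rewrite !mxE rmorphB. Qed.
HB.instance Definition _ := GRing.isZmodMorphism.Build A A ctr ctr_is_zmod_morphism.

Lemma ctrM M1 M2 : ctr (M1 * M2) = ctr M2 * ctr M1.
Proof. by rewrite /ctr -!mulmxE trmx_mul map_mxM. Qed.

Lemma ctrK : involutive ctr.
Proof. by move=> M; apply/matrixP => i j; rewrite !mxE conjCK. Qed.

Lemma ctrZ (a : R) M : ctr (a%:C *: M) = a%:C *: ctr M.
Proof.
apply/matrixP => i j; rewrite !mxE rmorphM; congr (_ * _).
by rewrite /= /Num.conj/= oppr0.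
Qed.

(** Entries are complex polynomials evaluated at real points; taking phi to be the
    real or the imaginary part reduces them to real polynomials. *)
Definition part_poly (phi : C -> R) Q (i j : 'I_N'.+1) : {poly R} :=
  \poly_(k < size Q) phi (Q`_k i j).

Section Part.
Variable phi : {additive C -> R}.
Hypothesis phiZ : forall (a : R) z, phi (a%:C * z) = a * phi z.

Lemma horner_mx_real Q (x : R) :
  Q.[x%:C%:M] = \sum_(k < size Q) (x ^+ k)%:C *: Q`_k.
Proof.
rewrite horner_coef; apply: eq_bigr => k _.
by rewrite -rmorphXn/= -mulmxE mul_mx_scalar rmorphXn.
Qed.

Lemma part_polyE Q i j x : (part_poly phi Q i j).[x] = phi (Q.[x%:C%:M] i j).
Proof.
rewrite horner_mx_real summxE raddf_sum /part_poly horner_poly.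
by apply: eq_bigr => k _; rewrite mxE phiZ mulrC.
Qed.

Lemma gauss_int_part Q i j :
  gauss_int (part_poly phi Q i j) = phi (moment cmoment Q i j).
Proof.
rewrite (@gauss_intE _ (size Q)) ?size_poly// /moment summxE raddf_sum.
by apply: eq_bigr => k _; rewrite coef_poly ltn_ord mxE phiZ mulrC.
Qed.
End Part.

Definition cRe (z : C) : R := complex.Re z.
Definition cIm (z : C) : R := complex.Im z.

Fact cRe_is_zmod_morphism : zmod_morphism cRe. Proof. by move=> [a b] [c d]. Qed.
HB.instance Definition _ := GRing.isZmodMorphism.Build C R cRe cRe_is_zmod_morphism.
Fact cIm_is_zmod_morphism : zmod_morphism cIm. Proof. by move=> [a b] [c d]. Qed.
HB.instance Definition _ := GRing.isZmodMorphism.Build C R cIm cIm_is_zmod_morphism.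

Lemma cReZ (a : R) (z : C) : cRe (a%:C * z) = a * cRe z.
Proof. by case: z => u v /=; rewrite /cRe/= mul0r subr0. Qed.
Lemma cImZ (a : R) (z : C) : cIm (a%:C * z) = a * cIm z.
Proof. by case: z => u v /=; rewrite /cIm/= mul0r addr0. Qed.

Lemma mx_integral_gauss Q :
  mx_integral (fun x => (expR (- x ^+ 2))%:C *: Q.[x%:C%:M]) = moment cmoment Q.
Proof.
apply/matrixP => i j; rewrite mxE; apply/eqP; rewrite eq_complex/=.
apply/andP; split; apply/eqP.
  rewrite -[RHS]/(cRe _) -(gauss_int_part cReZ); apply: eq_Rintegral => x _.
  by rewrite mxE -[LHS]/(cRe _) cReZ mulrC /gauss_poly (part_polyE cReZ).
rewrite -[RHS]/(cIm _) -(gauss_int_part cImZ); apply: eq_Rintegral => x _.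
by rewrite mxE -[LHS]/(cIm _) cImZ mulrC /gauss_poly (part_polyE cImZ).
Qed.

Local Notation pst := (map_poly ctr).

Lemma horner_realM Q1 Q2 (x : R) :
  (Q1 * Q2).[x%:C%:M] = Q1.[x%:C%:M] * Q2.[x%:C%:M].
Proof. by apply: hornerM_comm; rewrite /comm_poly -!mulmxE scalar_mxC. Qed.

Lemma horner_pst Q (x : R) : (pst Q).[x%:C%:M] = ctr Q.[x%:C%:M].
Proof.
rewrite !horner_mx_real size_pst; last exact: ctrK.
by rewrite raddf_sum; apply: eq_bigr => k _; rewrite coef_pst /= ctrZ.
Qed.

Lemma diagCE n (v : 'I_n -> R) i j : diagC v i j = (v i *+ (i == j))%:C.
Proof. by rewrite !mxE rmorphMn. Qed.

(** The real part of a diagonal entry of the integrand is a sum of squares with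
    positive coefficients, so it is a nonnegative real polynomial with integral 0. *)
Lemma moment_form_eq0 (delta : 'I_N'.+1 -> R) (E : {poly A}) :
  (forall i, 0 < delta i) ->
  moment cmoment (E * (diagC delta : A)%:P * pst E) = 0 -> E = 0.
Proof.
move=> d0 mE0; set Q := E * _ * _ in mE0.
have QE i x : (part_poly cRe Q i i).[x] =
    \sum_j delta j * (cRe (E.[x%:C%:M] i j) ^+ 2 + cIm (E.[x%:C%:M] i j) ^+ 2).
  rewrite (part_polyE cReZ) /Q !horner_realM hornerC horner_pst -!mulmxE mul_mx_diag.
  rewrite mxE raddf_sum; apply: eq_bigr => j _; rewrite !mxE.
  case: (E.[_] i j) => u v; rewrite /cRe/cIm/=.
  ring.
have Q0 i : part_poly cRe Q i i = 0.
  apply: integral_gauss_poly_eq0.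
    move=> x; rewrite QE sumr_ge0// => j _.
    by rewrite mulr_ge0 ?addr_ge0 ?sqr_ge0// ltW.
  by rewrite -/(gauss_int _) (gauss_int_part cReZ) mE0 mxE.
have E0 (x : R) i j : E.[x%:C%:M] i j = 0.
  have := QE i x; rewrite Q0 horner0 => /esym/eqP.
  rewrite psumr_eq0 => [/allP/(_ j (mem_index_enum _))|k _]; last first.
    by rewrite mulr_ge0 ?addr_ge0 ?sqr_ge0// ltW.
  rewrite mulf_eq0 gt_eqF//= paddr_eq0 ?sqr_ge0// !sqrf_eq0 => /andP[/eqP re /eqP im].
  by apply/eqP; rewrite eq_complex; apply/andP; split; apply/eqP.
apply/polyP => k; apply/matrixP => i j; rewrite coef0 mxE.
apply/eqP; rewrite eq_complex; apply/andP; split; apply/eqP.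
  rewrite -[LHS]/(cRe _).
  have : part_poly cRe E i j = 0.
    by apply: poly_eq0_nat => n; rewrite (part_polyE cReZ) E0 raddf0.
  move/polyP/(_ k); rewrite coef_poly coef0; case: ltnP => // kE _.
  by rewrite nth_default// mxE raddf0.
rewrite -[LHS]/(cIm _).
have : part_poly cIm E i j = 0.
  by apply: poly_eq0_nat => n; rewrite (part_polyE cImZ) E0 raddf0.
move/polyP/(_ k); rewrite coef_poly coef0; case: ltnP => // kE _.
by rewrite nth_default// mxE raddf0.
Qed.

(** Pairwise orthogonality gives orthogonality to all polynomials of smaller degree,
    because those are left combinations of the P m. *)
Lemma monic_orthogonal_ops (W : R -> A) (w : {poly A}) (P : nat -> {poly A}) :
  (forall x, W x = (expR (- x ^+ 2))%:C *: w.[x%:C%:M]) ->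
  monic_orthogonal W P -> monic_ops cmoment ctr w P.
Proof.
move=> WE [sP mP oP] n; split=> // Q.
have oPm m : n <> m -> ip cmoment ctr w (P n) (P m) = 0.
  move=> /oP <-; rewrite /ip -mx_integral_gauss; congr mx_integral.
  apply/funext => x; rewrite WE /eval_mx !horner_realM horner_pst !mulmxE.
  by rewrite -scalerAr -scalerAl.
suff h m Q' : (m <= n)%N -> (size Q' <= m)%N -> ip cmoment ctr w (P n) Q' = 0.
  exact: h.
elim: m Q' => [|m IH] Q' mn.
  by rewrite leqn0 size_poly_eq0 => /eqP ->; rewrite raddf0.
move=> Qm; rewrite -[Q'](subrK ((Q'`_m)%:P * P m)) raddfD/=.
rewrite ipCr; last exact: ctrM.
rewrite oPm ?mul0r ?addr0; last by move=> nm; rewrite nm ltnn in mn.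
apply: IH; first exact: ltnW.
apply/leq_sizeP => j; rewrite coefB coefCM leq_eqVlt => /predU1P[<-|mj].
  have := mP m; rewrite monicE lead_coefE sP => /eqP ->.
  by rewrite mulr1 subrr.
rewrite [Q'`_j]nth_default ?(leq_trans Qm)//.
by rewrite [(P m)`_j]nth_default ?sP// mulr0 subrr.
Qed.

End MatrixMoments.

(** * The shift matrix and its companions *)

Section Matrices.
Variables (R : realType) (N' : nat).
Local Notation C := R[i].
Local Notation A := 'M[C]_N'.+1.
Local Notation N := N'.+1.
Implicit Types (v u : 'I_N -> R) (alpha : 'I_N -> R) (M : A).

Lemma diagCM v u : diagC v *m diagC u = diagC (fun i => v i * u i).
Proof.
rewrite mul_mx_diag; apply/matrixP => i j; rewrite !mxE rmorphM/=.
by case: eqP => [->|_]; rewrite ?mulr1n// !mulr0n mul0r.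
Qed.

Lemma diagCD v u : diagC v + diagC u = diagC (fun i => v i + u i).
Proof. by apply/matrixP => i j; rewrite !mxE -mulrnDl -rmorphD. Qed.

Lemma diagCB v u : diagC v - diagC u = diagC (fun i => v i - u i).
Proof. by apply/matrixP => i j; rewrite !mxE -mulrnBl -rmorphB. Qed.

Lemma diagCZ (a : R) v : a%:C *: diagC v = diagC (fun i => a * v i).
Proof. by apply/matrixP => i j; rewrite !mxE mulrnAr -rmorphM. Qed.

Lemma diagC_cst (a : R) : a%:C%:M = diagC (fun=> a) :> A.
Proof. by apply/matrixP => i j; rewrite !mxE. Qed.

Lemma diagC1 : 1 = diagC (fun=> 1) :> A.
Proof. exact: (diagC_cst 1). Qed.

Lemma diagC_nat n : n%:R = diagC (fun=> n%:R) :> A.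
Proof. by rewrite -diagC_cst !rmorph_nat. Qed.

Lemma diagC_alg (a : R) : (a%:C)%:A = diagC (fun=> a) :> A.
Proof. by rewrite -diagC_cst -scalemx1. Qed.

Lemma diagCMn v n : diagC v *+ n = diagC (fun i => v i *+ n).
Proof. by apply/matrixP => i j; rewrite mulmxnE !mxE rmorphMn mulrnAC. Qed.

Lemma eq_diagC v u : v =1 u -> diagC v = diagC u.
Proof. by move=> /funext ->. Qed.

Lemma diagC_inj v u : diagC v = diagC u -> v =1 u.
Proof. by move=> /matrixP vu i; have := vu i i; rewrite !diagCE eqxx => -[]. Qed.

Lemma ctr_diagC v : ctr (diagC v) = diagC v.
Proof.
apply/matrixP => i j; rewrite !mxE eq_sym.
by case: eqP => [->|_]; rewrite ?mulr1n ?mulr0n ?rmorph0// /Num.conj/= oppr0.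
Qed.

Lemma diagC_mulV v : (forall i, v i != 0) ->
  (diagC v : A) * diagC (fun i => (v i)^-1) = 1.
Proof.
by move=> v0; rewrite -mulmxE diagCM diagC1; apply: eq_diagC => i; rewrite divff.
Qed.

Lemma diagC_unit v : (forall i, v i != 0) -> (diagC v : A) \is a GRing.unit.
Proof. by move=> v0; have /mulmx1_unit[] := diagC_mulV v0. Qed.

Lemma invmx_diagC v : (forall i, v i != 0) ->
  invmx (diagC v) = diagC (fun i => (v i)^-1).
Proof.
move=> v0; rewrite -[RHS](mulKmx (diagC_unit v0)).
have -> : diagC v *m diagC (fun i => (v i)^-1) = 1%:M := diagC_mulV v0.
by rewrite mulmx1.
Qed.

(** Commuting with diagC v only constrains the entries (i, j) with v i <> v j. *)
Lemma diagC_comm v u M : (forall i j, v i = v j -> u i = u j) ->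
  (diagC v : A) * M = M * diagC v -> diagC u * M = M * diagC u.
Proof.
move=> vu /matrixP vM; apply/matrixP => i j; have := vM i j.
rewrite -!mulmxE !mul_mx_diag !mul_diag_mx !mxE.
have [->|M0] := eqVneq (M i j) 0; first by rewrite !mulr0 !mul0r.
rewrite [X in X = _]mulrC => /(mulfI M0)/(congr1 (@complex.Re R))/= /vu ->.
by rewrite mulrC.
Qed.

Lemma conjSE alpha M i j : (forall i, alpha i <> 0) ->
  conjS alpha M i j = (alpha i / alpha j)%:C * M i j.
Proof.
move=> a0; rewrite /conjS invmx_diagC; last by move=> k; apply/eqP.
by rewrite mul_mx_diag mul_diag_mx !mxE rmorphM/= mulrAC.
Qed.

Lemma AmxE i j : Amx N i j = 2 *+ (i == j.+1 :> nat) :> C.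
Proof.
rewrite /Amx mxE summxE (bigD1 i)//= [X in _ + X]big1 ?addr0; last first.
  by move=> k ki; rewrite summxE big1// => l _; rewrite mxE eq_sym (negPf ki).
rewrite summxE.
have [ij|ij] := boolP (i == j.+1 :> nat).
  rewrite (bigD1 j)//= big1 ?addr0; first by rewrite mxE !eqxx mulr1.
  by move=> k /andP[_ kj]; rewrite mxE [j == k]eq_sym (negPf kj) andbF.
rewrite big1 ?mulr0// => k ik; rewrite mxE eqxx/=.
by case: eqP => // jk; rewrite jk ik in ij.
Qed.

Definition smx alpha : A := 2^-1 *: conjS alpha (Amx N).
Definition fmx alpha : A :=
  Jmx N *m (N%:R%:M - Jmx N) *m (2^-1 *: conjS alpha ((Amx N)^t*)).

Section Alpha.
Variable alpha : 'I_N -> R.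
Hypothesis alpha_neq0 : forall i, alpha i <> 0.
Let a0 i : alpha i != 0. Proof. exact/eqP. Qed.

Lemma smxE i j : smx alpha i j = ((alpha i / alpha j) *+ (i == j.+1 :> nat))%:C.
Proof.
rewrite mxE conjSE// AmxE; case: eqP => _; last by rewrite !mulr0n !mulr0.
by rewrite !mulr1n mulrC mulfK ?pnatr_eq0.
Qed.

Lemma fmxE i j : fmx alpha i j =
  (i.+1%:R * (N%:R - i.+1%:R) * (alpha i / alpha j) *+ (j == i.+1 :> nat))%:C.
Proof.
rewrite /fmx; have -> : N%:R%:M = diagC (fun=> N%:R) :> A.
  by rewrite -diagC_cst (rmorph_nat (real_complex R)).
rewrite /Jmx diagCB diagCM mul_diag_mx mxE [X in _ * X]mxE conjSE//.
rewrite mxE [X in _ * (_ * (_ * X))]mxE mxE AmxE.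
case: eqP => _; last by rewrite !mulr0n rmorph0 !mulr0.
rewrite !mulr1n rmorph_nat [(_ / _)%:C * _]mulrC mulKf ?pnatr_eq0//.
by rewrite [RHS]rmorphM.
Qed.

Lemma smxXE k i j :
  (smx alpha ^+ k) i j = ((alpha i / alpha j) *+ (i == j + k :> nat)%N)%:C.
Proof.
elim: k i j => [|k IH] i j.
  rewrite expr0 mxE addn0; have [->|] := eqVneq i j; first by rewrite eqxx divff.
  by rewrite -val_eqE => /negPf ->; rewrite rmorph0.
rewrite exprSr -mulmxE mxE; under eq_bigr do rewrite IH smxE.
have [jN|jN] := ltnP j.+1 N; last first.
  rewrite big1 => [|l _]; last first.
    by rewrite (ltn_eqF (leq_trans (ltn_ord l) jN)) mulr0n rmorph0 mulr0.
  have iN : (i < j + k.+1)%N.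
    by rewrite addnS -addSn (leq_trans (ltn_ord i)) ?(leq_trans jN) ?leq_addr.
  by rewrite (ltn_eqF iN) mulr0n rmorph0.
rewrite (bigD1 (Ordinal jN))//= eqxx big1 ?addr0; last first.
  by move=> l; rewrite -val_eqE => /negPf/= ->; rewrite mulr0n rmorph0 mulr0.
rewrite addSnnS mulr1n; case: eqP => _; last by rewrite rmorph0 mul0r.
by rewrite !mulr1n -rmorphM mulrA divfK.
Qed.

Lemma smx_nilp : smx alpha ^+ N = 0.
Proof.
apply/matrixP => i j; rewrite smxXE mxE ltn_eqF// (leq_trans (ltn_ord i))//.
exact: leq_addl.
Qed.

Lemma smx_J : smx alpha * Jmx N = Jmx N * smx alpha - smx alpha.
Proof.
apply/matrixP => i j; rewrite -!mulmxE /Jmx mul_mx_diag mul_diag_mx.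
rewrite mxE [RHS]mxE [X in _ = X + _]mxE [X in _ = _ + X]mxE smxE.
rewrite [(\row__ _) _ _]mxE [(\row__ _) _ _]mxE.
case: eqP => [->|_]; last by rewrite mulr0n rmorph0 mul0r mulr0 subr0.
by rewrite mulr1n mulrC -!rmorphM -rmorphB -[j.+2%:R]natr1 mulrDl mul1r addrK.
Qed.

(** The entries of alpha cancel in such a product, which is why they are absent
    from the outcome. *)
Lemma smx_diag_fmx (v : nat -> R) :
  smx alpha * diagC (fun i => v i) * fmx alpha =
  diagC (fun i : 'I_N => i%:R * (N%:R - i%:R) * v i.-1).
Proof.
apply/matrixP => i j; rewrite -!mulmxE mul_mx_diag mxE diagCE.
under eq_bigr do rewrite mxE smxE fmxE [(\row_ _ _) _ _]mxE.
case: i => -[|i] iN /=.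
  by rewrite big1 ?mul0r ?mul0rn// => l _; rewrite rmorph0 !mul0r.
rewrite (bigD1 (Ordinal (ltnW iN)))//= eqxx big1 ?addr0; last first.
  move=> l; rewrite -val_eqE eqSS eq_sym => /negPf/= ->.
  by rewrite mulr0n rmorph0 !mul0r.
rewrite -val_eqE /= eq_sym; case: eqP => [jE|_]; last by rewrite rmorph0 mulr0.
rewrite -!rmorphM; congr (_%:C).
have -> : j = Ordinal iN by apply: val_inj.
by rewrite !mulr1n; field; rewrite !a0.
Qed.

Lemma fmx_smx : fmx alpha * smx alpha =
  diagC (fun i : 'I_N => i.+1%:R * (N%:R - i.+1%:R)).
Proof.
apply/matrixP => i j; rewrite -mulmxE mxE diagCE.
under eq_bigr do rewrite smxE fmxE.
have [iN|iN] := ltnP i.+1 N; last first.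
  rewrite big1 => [|l _]; last first.
    by rewrite (ltn_eqF (leq_trans (ltn_ord l) iN)) mulr0n rmorph0 mul0r.
  have -> : i.+1 = N by apply/eqP; rewrite eqn_leq iN ltn_ord.
  by rewrite subrr mulr0 mul0rn.
rewrite (bigD1 (Ordinal iN))//= eqxx big1 ?addr0; last first.
  by move=> l; rewrite -val_eqE => /negPf/= ->; rewrite mulr0n rmorph0 mul0r.
rewrite eqSS -val_eqE /=; case: eqP => [ij|_]; last by rewrite rmorph0 mulr0.
rewrite -!rmorphM; congr (_%:C).
have -> : j = i by apply: val_inj.
by rewrite !mulr1n; field; rewrite !a0.
Qed.

Lemma smx_f : smx alpha * fmx alpha = fmx alpha * smx alpha + (Jmx N *+ 2 - N.+1%:R).
Proof.
have := smx_diag_fmx (fun=> 1); rewrite -diagC1 mulr1 => ->.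
rewrite fmx_smx /Jmx diagCMn diagC_nat diagCB diagCD; apply: eq_diagC => i.
by rewrite -!natr1; ring.
Qed.

End Alpha.
End Matrices.

(** * The family of Hermite-type weights *)

Section HermiteWeights.
Variables (R : realType) (N' : nat) (H : nat -> {poly R}).
Variables (alpha : 'I_N'.+1 -> R) (nu0 : R) (delta : R -> 'I_N'.+1 -> R) (c d : R -> R).
Local Notation C := R[i].
Local Notation A := 'M[C]_N'.+1.
Local Notation N := N'.+1.
Hypothesis hH : hermite_polys H.
Hypothesis alpha_neq0 : forall i, alpha i <> 0.
Hypothesis delta_gt0 : forall nu, nat_shift nu0 nu -> forall i, 0 < delta nu i.
Hypothesis c_gt0 : forall nu, nat_shift nu0 nu -> 0 < c nu.
Hypothesis d_gt0 : forall nu, nat_shift nu0 nu -> 0 < d nu.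
Hypothesis deltaS : forall nu, nat_shift nu0 nu ->
  diagC (delta (nu + 1)) =
    ((d nu)%:C *: Jmx N + (c nu)%:C%:M) *m diagC (delta nu).
Hypothesis alphaS : forall nu, nat_shift nu0 nu ->
  forall i j : 'I_N, j = i.+1 :> nat ->
  let k : R := i.+1%:R in
  alpha j ^+ 2 / alpha i ^+ 2 =
    (d nu * k * (N%:R - k)) / (2 * (d nu * k + c nu)) * (delta nu j / delta nu i).

Local Notation s := (smx alpha).
Local Notation J := (Jmx N : A).
Local Notation f := (fmx alpha).
Local Notation pst := (map_poly (@ctr R N')).
Local Notation mom := (moment (@cmoment R)).

Definition chermite j : {poly C} := map_poly (real_complex R) (nhermite H j).

Lemma chermite0 : chermite 0 = 1.
Proof. by rewrite /chermite nhermite0// rmorph1. Qed.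

Lemma chermiteS j : chermite j.+1 *+ j.+1 =
  ('X * chermite j - (if j is i.+1 then chermite i else 0)) *+ 2.
Proof.
have -> : ('X * chermite j - (if j is i.+1 then chermite i else 0)) *+ 2 =
   map_poly (real_complex R) (('X * nhermite H j -
     (if j is i.+1 then nhermite H i else 0)) *+ 2).
  rewrite rmorphMn rmorphB rmorphM/= map_polyX.
  by case: j => [|j]; rewrite ?rmorph0.
rewrite /chermite -rmorphMn -[_ *+ j.+1](@scaler_nat R) nhermiteS//.
rewrite -[_ *+ 2 in RHS](@scaler_nat R) scalerBr; congr (map_poly _ _).
by case: j => [|j]; rewrite ?scaler0.
Qed.

Lemma LpolyE x : (Lpoly s chermite N).[x%:C%:M] = conjS alpha (Lmx N H x).
Proof.
have term k i j : ((map_poly (in_alg A) (chermite k)) * s%:P ^+ k).[x%:C%:M] i j =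
    ((nhermite H k).[x] * (alpha i / alpha j *+ (i == j + k :> nat)%N))%:C.
  rewrite horner_realM -rmorphXn hornerC -[x%:C%:M]scalemx1 -[_ *: _]/(in_alg A _).
  rewrite horner_map/= /chermite horner_map/= mulr_algl mxE smxXE//.
  by rewrite [RHS]rmorphM.
apply/matrixP => i j; rewrite conjSE// mxE /Lpoly /nilp_sum horner_sum summxE.
under eq_bigr do rewrite term.
have [ji|ij] := leqP j i; last first.
  rewrite mulr0 big1// => k _; rewrite ltn_eqF ?mulr0n ?mulr0//.
  by rewrite (leq_trans ij) ?leq_addr.
have ijN : (i - j < N.+1)%N by rewrite ltnS (leq_trans (leq_subr _ _))// ltnW.
(* Only the power i - j of s has a nonzero entry (i, j). *)
rewrite (bigD1 (Ordinal ijN))//= subnKC// eqxx big1 ?addr0 => [|k kij].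
  by rewrite /nhermite hornerZ -rmorphM mulr1n; congr (_%:C); ring.
rewrite [_ == _](_ : _ = false) ?mulr0n ?mulr0//.
apply: contraNF kij => /eqP ijk; apply/eqP/val_inj => /=.
by rewrite ijk addKn.
Qed.

Definition wH nu : {poly A} := wpoly (@ctr R N') s chermite N (diagC (delta nu)).

Lemma weightE nu x :
  weight H alpha delta nu x = (expR (- x ^+ 2))%:C *: (wH nu).[x%:C%:M].
Proof.
by rewrite /wH /wpoly !horner_realM hornerC horner_pst LpolyE.
Qed.

Lemma pst_wH nu : pst (wH nu) = wH nu.
Proof. by apply: pst_wpoly; [exact: ctrM|exact: ctrK|exact: ctr_diagC]. Qed.

(** Cancel the invertible factor Lpoly after using definiteness for the diagonal
    part. *)
Lemma ip_wH_eq0 nu P : nat_shift nu0 nu ->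
  ip (@cmoment R) (@ctr R N') (wH nu) P P = 0 -> P = 0.
Proof.
move=> hnu; rewrite /ip /wH /wpoly.
rewrite -!mulrA -pstM; last exact: ctrM.
rewrite !mulrA => /(moment_form_eq0 (delta_gt0 hnu)) h.
by apply: (Lpoly_rreg chermite0 (smx_nilp alpha_neq0)); rewrite h mul0r.
Qed.

(** All coefficients depend on c and d only through this ratio. *)
Definition rH nu : R := c nu / d nu.
(** Row i carries the index i + 1 in J, so the diagonal of N + 1 - J + r is N - i + r. *)
Definition KH (r : R) : A := diagC (fun i => N%:R - i%:R + r).
Definition bH (r : R) : A :=
  s + 2^-1 *: (diagC (fun i => (N%:R - i%:R + r)^-1) * f).
(** The coefficient C_n is n times this matrix at r = c / d taken at nu + n - 1. *)
Definition eH (r : R) : A :=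
  diagC (fun i => (1 + r) * (N%:R + r + 1) /
     (2 * (N%:R + r + 1 - i%:R) * (N%:R + r - i%:R))).

Lemma rH_gt0 nu : nat_shift nu0 nu -> 0 < rH nu.
Proof. by move=> h; rewrite divr_gt0 ?c_gt0 ?d_gt0. Qed.

Lemma KH_gt0 (r : R) (i : 'I_N) : 0 < r -> 0 < N%:R - i%:R + r.
Proof. by move=> r0; rewrite ltr_wpDl// subr_ge0 ler_nat ltnW. Qed.

Lemma KHE (r : R) : N.+1%:R + (r%:C)%:A - J = KH r.
Proof.
rewrite diagC_nat diagC_alg /Jmx diagCD diagCB; apply: eq_diagC => i.
by rewrite -!natr1; ring.
Qed.

Lemma KHb r : 0 < r -> KH r * bH r *+ 2 = KH r * s *+ 2 + f.
Proof.
move=> r0; rewrite /bH mulrDr mulrnDl; congr (_ + _).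
rewrite -scalerAr -[_ *+ 2](@scaler_nat C) scalerA mulfV ?pnatr_eq0// scale1r.
by rewrite mulrA diagC_mulV ?mul1r// => i; rewrite gt_eqF// KH_gt0.
Qed.

Section Step.
Variable nu : R.
Hypothesis hnu : nat_shift nu0 nu.
Let r := rH nu.

Lemma deltaSE : diagC (delta (nu + 1)) =
  (d nu)%:C *: ((J + (r%:C)%:A) * diagC (delta nu)) :> A.
Proof.
rewrite deltaS// mulmxE scalerAl scalerDr; congr ((_ + _) * _).
rewrite scalerA -rmorphM /r /rH mulrC divfK ?gt_eqF ?d_gt0//.
by rewrite scalemx1.
Qed.

Lemma deltaS_coef i : delta (nu + 1) i = d nu * (i.+1%:R + r) * delta nu i.
Proof.
have := deltaSE; rewrite diagC_alg /Jmx diagCD -mulmxE diagCM diagCZ.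
by move/diagC_inj => ->; rewrite mulrA.
Qed.

(** The hypothesis on alpha, read entrywise. *)
Lemma deltaSs : diagC (delta (nu + 1)) * ctr s *+ 2 =
  (d nu)%:C *: (f * diagC (delta nu)) :> A.
Proof.
apply/matrixP => i j; rewrite mulmxnE -!mulmxE mul_diag_mx mul_mx_diag.
rewrite mxE [RHS]mxE [X in _ = _ * X]mxE fmxE// [(\row__ _) _ _]mxE [(\row__ _) _ _]mxE.
rewrite mxE mxE smxE//.
have [ij|_] := eqVneq (j : nat) i.+1; last first.
  by rewrite !mulr0n !rmorph0 mul0r !mulr0 mul0rn.
rewrite !mulr1n [X in _ * X *+ _](_ : _ = (alpha j / alpha i)%:C); last first.
  by rewrite /Num.conj/= oppr0.
rewrite -!rmorphM -rmorphMn; congr (_%:C); rewrite deltaS_coef.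
have := alphaS hnu ij; rewrite /= (_ : c nu = d nu * r); last first.
  by rewrite mulrC divfK// gt_eqF// d_gt0.
have d0 := d_gt0 hnu; have r0 := rH_gt0 hnu; rewrite -/r in r0.
have := delta_gt0 hnu i; set k : R := i.+1%:R => del0 aE.
have k0 : 0 < k by rewrite ltr0n.
have ai : alpha i != 0 by apply/eqP.
have aj : alpha j != 0 by apply/eqP.
have -> : alpha j / alpha i = alpha j ^+ 2 / alpha i ^+ 2 * (alpha i / alpha j).
  by field; rewrite ai aj.
rewrite aE; field.
by rewrite aj (gt_eqF del0) -mulrDr mulf_neq0 ?nat1r ?gt_eqF ?addr_gt0.
Qed.

Let hr : 0 < r. Proof. exact: rH_gt0. Qed.
Let PhiH : {poly A} := Phi s J (d nu)%:C (r%:C).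
Let PsiH : {poly A} := Psi J N (bH r) (d nu)%:C (r%:C).

Lemma wH_step : wH (nu + 1) = PhiH * wH nu.
Proof.
exact: (wpoly_step _ chermiteS (smx_nilp alpha_neq0) (smx_J alpha_neq0) deltaSE).
Qed.

Lemma wH_deriv : (wH (nu + 1))^`() - ('X * wH (nu + 1)) *+ 2 = PsiH * wH nu.
Proof.
apply: (wpoly_deriv (@ctrM R N') chermite0 chermiteS (smx_nilp alpha_neq0)
  (smx_J alpha_neq0) (smx_f alpha_neq0) deltaSE deltaSs).
by rewrite KHE KHb.
Qed.

Definition kappaH : A := ((d nu)%:C *: KH r) *+ 2.

Lemma kappaHE : kappaH = diagC (fun i => d nu * (N%:R - i%:R + r) *+ 2).
Proof. by rewrite /kappaH diagCZ diagCMn. Qed.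

Lemma kappaH_unit : kappaH \is a GRing.unit.
Proof.
rewrite kappaHE; apply: diagC_unit => i.
by rewrite mulrn_eq0/= mulf_neq0 ?gt_eqF ?KH_gt0 ?d_gt0.
Qed.

Lemma PsiHE : PsiH = - (kappaH%:P * ('X - (bH r)%:P)).
Proof. by rewrite /PsiH /Psi KHE. Qed.

Definition DH : 'I_N -> R :=
  fun i => d nu * (1 + r) * (N%:R + r + 1) / (N%:R + r + 1 - i%:R).

Lemma den_gt0 (i : 'I_N) : 0 < N%:R + r + 1 - i%:R.
Proof. have := KH_gt0 i hr; lra. Qed.

(** The matrix of moment_Phi is J + r - s K^-1 f up to the factor d, and s K^-1 f
    is diagonal. *)
Lemma moment_wH_step : mom (wH (nu + 1)) = diagC DH * mom (wH nu).
Proof.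
have mX : mom ('X * wH nu) = bH r * mom (wH nu).
  apply: (moment_XsubC (@cmomentS R) wH_deriv (mulrI kappaH_unit) PsiHE).
rewrite wH_step (moment_Phi _ _ _ _ mX) scalerAl; congr (_ * _).
rewrite /bH [s + _ - _]addrAC subrr add0r -scalerAr.
rewrite -[_ *+ 2](@scaler_nat C) scalerA mulfV ?pnatr_eq0// scale1r mulrA.
pose v (i : nat) := (N%:R - i%:R + r)^-1.
rewrite (smx_diag_fmx alpha_neq0 v) diagC_alg /Jmx diagCD diagCB diagCZ.
apply: eq_diagC => i; rewrite /DH /v.
have := den_gt0 i; case: i => -[|i] iN /=; rewrite -?natr1 => h.
  have hN : 0 <= (N'%:R : R) := ler0n _ _.
  have r0 : 0 < r := hr.
  by field; apply/andP; split; apply: lt0r_neq0; lra.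
by field; apply: lt0r_neq0; lra.
Qed.

(** The total masses for nu and nu + 1 are Hermitian and differ by the real diagonal
    factor DH, which therefore commutes with the mass; kappaH is a function of DH. *)
Lemma kappa_comm : kappaH * mom (wH nu) = mom (wH nu) * kappaH.
Proof.
have sM u : ctr (mom (wH u)) = mom (wH u).
  rewrite -moment_pst ?pst_wH//; first exact: ctrK.
  by move=> k M; exact: ctrZ.
rewrite kappaHE; apply: (@diagC_comm _ _ DH) => [i j DHij|].
  have k0 : d nu * (1 + r) * (N%:R + r + 1) != 0.
    by rewrite !mulf_neq0 ?gt_eqF ?d_gt0 ?addr_gt0.
  congr (d nu * _ *+ 2); move: DHij => /(mulfI k0)/invr_inj; lra.
by rewrite -moment_wH_step -[LHS]sM moment_wH_step ctrM sM ctr_diagC.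
Qed.

Lemma eHE : eH r * mom (wH nu) * kappaH = mom (wH (nu + 1)).
Proof.
rewrite -mulrA -kappa_comm mulrA moment_wH_step; congr (_ * _).
rewrite kappaHE -mulmxE diagCM; apply: eq_diagC => i; rewrite /DH.
have := KH_gt0 i hr; have := den_gt0 i => h1 h2.
by field; apply/andP; split; apply: lt0r_neq0; lra.
Qed.

(** The ratio of alpha does not depend on nu; compare the hypothesis on alpha for
    nu and nu + 1 in the first row, which exists when N > 1. *)
Lemma rHS : (0 < N')%N -> rH (nu + 1) = r + 1.
Proof.
move=> N0; have i1 : (1 < N)%N by [].
have [k nuE] := hnu.
have hnu1 : nat_shift nu0 (nu + 1) by exists k.+1; rewrite nuE -natr1 addrA.
have := alphaS hnu (i := ord0) (j := Ordinal i1) erefl.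
rewrite (alphaS hnu1 (i := ord0) (j := Ordinal i1) erefl) !deltaS_coef /=.
have cE u : nat_shift nu0 u -> c u = d u * rH u.
  by move=> hu; rewrite mulrC divfK// gt_eqF// d_gt0.
rewrite (cE _ hnu) (cE _ hnu1) -/r.
have := d_gt0 hnu; have := d_gt0 hnu1; have := rH_gt0 hnu1.
have := delta_gt0 hnu ord0; have := delta_gt0 hnu (Ordinal i1).
have N0' : 0 < (N'%:R : R) by rewrite ltr0n.
move: (delta _ _) (delta _ _) (d _) (d _) (rH _) => y x d1 d0 r1.
move=> y0 x0 r10 d10 d00 e; have r0 : 0 < r := hr.
have nz : (N%:R - 1 != 0 :> R) && (x != 0) && (y != 0) && (d0 != 0) &&
    (d1 != 0) && (1 + r != 0) && (1 + r1 != 0).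
  by rewrite -natr1 addrK !gt_eqF ?addr_gt0.
(* Both sides of e are multiples of this number. *)
have Q0 : (N%:R - 1) * x / (2 * (1 + r) * y) != 0 :> R.
  by move: nz; rewrite !mulf_eq0 invr_eq0 !mulf_eq0 pnatr_eq0 => /=; do !case: eqP.
have : (2 + r) / (1 + r1) = 1.
  apply: (mulfI Q0); rewrite mulr1.
  move: nz => /andP[/andP[/andP[/andP[/andP[/andP[? ?] ?] ?] ?] ?] ?].
  have nd0 : d0 + d0 * r1 != 0 by rewrite -[X in X + _]mulr1 -mulrDr mulf_neq0.
  have nd1 : d1 + d1 * r != 0 by rewrite -[X in X + _]mulr1 -mulrDr mulf_neq0.
  have -> : (N%:R - 1) * x / (2 * (1 + r) * y) =
      d1 * 1 * (N%:R - 1) / (2 * (d1 * 1 + d1 * r)) * (x / y).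
    by field; apply/and3P.
  by rewrite -[in RHS]e; field; do ![apply/andP; split].
move=> /(congr1 (fun z => z * (1 + r1))); rewrite divfK ?gt_eqF ?addr_gt0// mul1r.
lra.
Qed.

End Step.
End HermiteWeights.

(** * Closed forms of the coefficients *)

Section Coefficients.
Variables (R : realType) (N' : nat).
Local Notation C := R[i].
Local Notation A := 'M[C]_N'.+1.
Local Notation N := N'.+1.
Variables (alpha : 'I_N -> R) (delta : R -> 'I_N -> R) (c d : R -> R) (nu : R).

Lemma KH_mx (r : R) : (N%:R%:M + 1%:M - Jmx N + r%:C%:M : A) = KH N' r.
Proof.
have -> : N%:R%:M = diagC (fun=> N%:R) :> A.
  by rewrite -diagC_cst (rmorph_nat (real_complex R)).
have -> : 1%:M = diagC (fun=> 1) :> A by exact: diagC1.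
rewrite diagC_cst /Jmx diagCD diagCB diagCD; apply: eq_diagC => i.
by rewrite -natr1; ring.
Qed.

Lemma invmx_KH (r : R) : 0 < r -> invmx (KH N' r) = diagC (fun i => (N%:R - i%:R + r)^-1).
Proof. by move=> r0; rewrite invmx_diagC// => i; rewrite gt_eqF// KH_gt0. Qed.

Lemma half_fmx (F : A) :
  4^-1 *: (F *m (Jmx N *m (N%:R%:M - Jmx N)) *m conjS alpha ((Amx N)^t*)) =
  2^-1 *: (F * fmx alpha).
Proof.
rewrite /fmx -mulmxE -!scalemxAr scalerA !mulmxA; congr (_ *: _).
by rewrite -invfM -natrM.
Qed.

Let r k := rH c d (nu + k%:R).

(** The three diagonal factors of Bcoef are the partial fraction
    (n+1) / K_n - n / K_(n-1) put over a common denominator. *)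
Lemma BcoefE n : (forall k, 0 < r k) ->
  Bcoef alpha c d nu n = bH alpha (r n) *+ n.+1 - bH alpha (r n.-1) *+ n.
Proof.
move=> r0; rewrite /Bcoef half_fmx !KH_mx -[c (nu + n%:R) / _]/(r n).
case: n => [|n] /=; first by rewrite invmx_KH// mulr1n mulr0n subr0.
have -> : nu + n.+1%:R - 1 = nu + n%:R by rewrite -natr1 addrA addrK.
rewrite -[c (nu + n%:R) / _]/(r n) !invmx_KH//.
have sub4 (x y z t : A) : x + y - (z + t) = (x - z) + (y - t).
  by rewrite opprD addrACA.
rewrite /bH !mulrnDl sub4.
have -> : smx alpha *+ n.+2 - smx alpha *+ n.+1 = smx alpha by rewrite mulrS addrK.
rewrite !scalerMnr -scalerBr -!mulrnAl -mulrBl; congr (_ + _ *: (_ * _)).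
rewrite /KH !diagCM !diagCMn diagCB; apply: eq_diagC => i.
have := KH_gt0 i (r0 n); have := KH_gt0 i (r0 n.+1).
rewrite -[_ *+ n.+2]mulr_natr -[_ *+ n.+1]mulr_natr -[n.+2%:R]natr1.
move: (N%:R) (i%:R) (r n.+1) (r n) => x y r1 r2 h1 h2.
by field; rewrite !gt_eqF.
Qed.

Lemma pochhammerSr (a : R) p : pochhammer a p.+1 = pochhammer a p * (a + p%:R).
Proof. exact: big_ord_recr. Qed.

Lemma pochhammerSl (a : R) p : pochhammer a p.+1 = a * pochhammer (a + 1) p.
Proof.
rewrite /pochhammer big_ord_recl addr0; congr (_ * _); apply: eq_bigr => i _.
by rewrite /= /bump /= natrD addrA.
Qed.

Lemma pochhammer_neq0 (a : R) p : a + p%:R <= 0 -> pochhammer a p != 0.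
Proof.
move=> ap; apply/prodf_neq0 => i _; rewrite lt_eqF// (lt_le_trans _ ap)//.
by rewrite ltrD2l ltr_nat.
Qed.

(** Both (a - 1)_p (a - 1 + p) and (a - 1) (a)_p equal (a - 1)_(p+1). *)
Lemma pochhammer_telescope (a : R) p : a + p%:R < 0 ->
  pochhammer (a - 1) p / pochhammer a p.+1 =
  (a - 1) / ((a - 1 + p%:R) * (a + p%:R)).
Proof.
move=> ap; have p0 : pochhammer a p != 0 by rewrite pochhammer_neq0// ltW.
have : pochhammer (a - 1) p * (a - 1 + p%:R) = (a - 1) * pochhammer a p.
  by rewrite -pochhammerSr pochhammerSl subrK.
rewrite pochhammerSr => e; have ap1 : a - 1 + p%:R < 0 by lra.
have -> : pochhammer (a - 1) p = (a - 1) * pochhammer a p / (a - 1 + p%:R).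
  by rewrite -e mulfK// lt_eqF.
by field; rewrite p0 !lt_eqF.
Qed.

(** For N > 1 the two symbols in the quotient have arguments differing by one and
    telescope; for N = 1 the quotient is explicit. *)
Lemma CcoefE n : 0 < d (nu + n%:R) -> 0 < r n ->
  delta (nu + n.+1%:R) ord0 / delta (nu + n%:R) ord0 = d (nu + n%:R) * (1 + r n) ->
  ((0 < N')%N -> r n.+1 = r n + 1) ->
  Ccoef delta c d nu n.+1 = eH N' (r n) *+ n.+1.
Proof.
move=> d0 r0 del rS; rewrite /Ccoef.
have -> : nu + n.+1%:R - 1 = nu + n%:R by rewrite -natr1 addrA addrK.
rewrite del -[c (nu + n%:R) / _]/(r n) -[c (nu + n.+1%:R) / _]/(r n.+1).
rewrite /eH diagCMn; apply: eq_diagC => p; rewrite -[RHS]mulr_natr.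
have hp := KH_gt0 p r0.
have [N0|N0] := posnP N'.
  have -> : (p : nat) = 0%N.
    by have := ltn_ord p; move: (p : nat) => q; rewrite N0 ltnS leqn0 => /eqP.
  rewrite /pochhammer big_ord0 big_ord1 N0 /= addr0 subr0.
  move: (n.+1%:R) (d _) (r n) d0 r0 => x y z y0 z0.
  field; do ![apply/andP; split];
    [apply: lt0r_neq0; lra|apply: lt0r_neq0; lra|apply: ltr0_neq0; lra|exact: lt0r_neq0].
rewrite (rS N0) opprD addrA.
move: (N%:R) (n.+1%:R) (d _) (r n) d0 r0 hp => x m y z y0 z0 hp.
rewrite pochhammer_telescope; last by lra.
field; do ![apply/andP; split]; [apply: lt0r_neq0|apply: lt0r_neq0|
  apply: ltr0_neq0|apply: ltr0_neq0|apply: lt0r_neq0]; lra.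
Qed.

End Coefficients.

(** * The three-term recurrence *)

Theorem proposition3p16 (R : realType) (N' : nat) (H : nat -> {poly R})
    (alpha : 'I_N'.+1 -> R) (nu0 : R) (delta : R -> 'I_N'.+1 -> R)
    (c d : R -> R)
    (hH : hermite_polys H)
    (alpha_neq0 : forall i, alpha i <> 0)
    (alpha1 : alpha ord0 = 1)
    (delta_gt0 : forall nu, nat_shift nu0 nu -> forall i, 0 < delta nu i)
    (c_gt0 : forall nu, nat_shift nu0 nu -> 0 < c nu)
    (d_gt0 : forall nu, nat_shift nu0 nu -> 0 < d nu)
    (deltaS : forall nu, nat_shift nu0 nu ->
       diagC (delta (nu + 1)) =
         ((d nu)%:C *: Jmx N'.+1 + (c nu)%:C%:M) *m diagC (delta nu))
    (alphaS : forall nu, nat_shift nu0 nu ->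
       forall i j : 'I_N'.+1, j = i.+1 :> nat ->
       let k : R := i.+1%:R in
       alpha j ^+ 2 / alpha i ^+ 2 =
         (d nu * k * (N'.+1%:R - k)) / (2 * (d nu * k + c nu))
           * (delta nu j / delta nu i))
    (nu : R) (hnu : nat_shift nu0 nu)
    (P : nat -> {poly 'M[R[i]]_N'.+1})
    (hP : monic_orthogonal (weight H alpha delta nu) P) (n : nat) :
  'X * P n = P n.+1 + (Bcoef alpha c d nu n)%:P * P n
             + (Ccoef delta c d nu n)%:P * (if n is m.+1 then P m else 0).
Proof.
(* The weights at nu, nu + 1, nu + 2 and so on are numbered from 0. *)
pose nuk k : R := nu + k%:R.
have nukE k : nu + k%:R = nuk k by [].
have nukS k : nuk k.+1 = nuk k + 1 by rewrite /nuk -natr1 addrA.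
have hk k : nat_shift nu0 (nuk k).
  by have [l nuE] := hnu; exists (l + k)%N; rewrite /nuk nuE natrD addrA.
pose r k := rH c d (nuk k).
have r0 k : 0 < r k by apply: rH_gt0 c_gt0 d_gt0 _ (hk k).
pose w k := wH H alpha delta (nuk k).
have opsP : monic_ops (@cmoment R) (@ctr R N') (w 0%N) P.
  apply: monic_orthogonal_ops hP => x; rewrite /w /nuk addr0.
  exact: weightE.
rewrite (BcoefE alpha n r0).
have -> : (Ccoef delta c d nu n)%:P * (if n is m.+1 then P m else 0) =
    (eH N' (r n.-1) *+ n)%:P * (if n is m.+1 then P m else 0).
  case: n => [|n]; first by rewrite !mulr0.
  have rS : (0 < N')%N -> r n.+1 = r n + 1.
    move=> N0; rewrite /r nukS.
    exact: (rHS delta_gt0 c_gt0 d_gt0 deltaS alphaS (hk n) N0).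
  have del : delta (nuk n.+1) ord0 / delta (nuk n) ord0 = d (nuk n) * (1 + r n).
    rewrite nukS (deltaS_coef d_gt0 deltaS (hk n)).
    by rewrite mulfK ?gt_eqF ?delta_gt0.
  by rewrite (CcoefE (d_gt0 _ (hk n)) (r0 n) del rS).
pose kappa k := kappaH N' c d (nuk k).
apply: (@three_term_recurrence _ _ _ _ (@cmomentS R) (@ctrM R N') (@ctrK R N')
  w (fun k => Phi (smx alpha) (Jmx N'.+1) (d (nuk k))%:C (r k)%:C)
  (fun k => Psi (Jmx N'.+1) N'.+1 (bH alpha (r k)) (d (nuk k))%:C (r k)%:C)
  kappa (fun k => bH alpha (r k)) (fun k => eH N' (r k)) _ _ _ _ _ _ _ _ _ _ P opsP n).
- by move=> k; exact: pst_wH.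
- move=> k; rewrite /w nukS.
  exact: (wH_step hH alpha_neq0 d_gt0 deltaS (hk k)).
- move=> k; rewrite /w nukS.
  exact: (wH_deriv hH alpha_neq0 delta_gt0 c_gt0 d_gt0 deltaS alphaS (hk k)).
- by move=> k; exact: size_Phi.
- move=> k; exact: PsiHE.
- by move=> k; rewrite /kappa kappaHE; exact: ctr_diagC.
- by move=> k; apply: mulrI; exact: (kappaH_unit _ c_gt0 d_gt0 (hk k)).
- by move=> k; apply: mulIr; exact: (kappaH_unit _ c_gt0 d_gt0 (hk k)).
- move=> k; rewrite /w nukS.
  exact: (eHE hH alpha_neq0 delta_gt0 c_gt0 d_gt0 deltaS alphaS (hk k)).
- move=> k Q; exact: (ip_wH_eq0 hH alpha_neq0 delta_gt0 (hk k)).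
Qed.
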